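(* Let $G$ be a connected graph of genus $g$. Then there are an integer $c=O(\log g)$, co-bipartite graphs $G_1,\dots,G_c$, a unit interval graph $G_{c+1}$, and a chordal graph $G_{c+2}$ such that $G=\bigcap_{i=1}^{c+2}G_i$. Here $c=O(\log g)$ means that there is a function $c(g)$ of $g$ alone, with $c(g)=O(\log g)$ as $g\to\infty$, such that for every $g$ and every connected graph $G$ of genus $g$ the representation exists with $c=c(g)$.
   Context: Graphs are finite, simple and undirected. $G=\bigcap_{i=1}^d G_i$ means that $V(G_i)=V(G)$ for all $i$ and $E(G)=\bigcap_{i=1}^d E(G_i)$. The genus of a graph is the smallest $g$ such that the graph can be embedded without crossings in the orientable surface of genus $g$. A co-bipartite graph is the complement of a bipartite graph. A unit interval graph is the intersection graph of a family of unit-length intervals on the real line (vertices correspond to intervals, two distinct vertices being adjacent iff their intervals intersect). A graph is chordal if it has no induced (chordless) cycle of length at least four. *)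

(* Defs.v *)
(* Finite graphs from MathComp; topology and asymptotics from MathComp-Analysis. *)
From HB Require Import structures.
From mathcomp Require Import all_boot all_order all_algebra.
From mathcomp Require Import all_classical all_reals all_analysis.
Import Order.TTheory GRing.Theory Num.Theory numFieldNormedType.Exports.
Set Implicit Arguments.
Unset Strict Implicit.
Unset Printing Implicit Defensive.
Local Open Scope classical_set_scope.
Local Open Scope ring_scope.

Record sgraph (T : finType) := SGraph {
  adj :> rel T;
  adj_sym : symmetric adj;
  adj_irrefl : irreflexive adj }.

Definition edge_set (T : finType) (G : sgraph T) : {set {set T}} :=
  [set [set p.1; p.2]%SET | p in [pred p : T * T | G p.1 p.2]]%SET.

Definition connected_graph (T : finType) (G : sgraph T) : Prop :=
  forall x y : T, connect G x y.

Lemma compl_sym (T : finType) (G : sgraph T) :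
  symmetric (fun x y => (x != y) && ~~ G x y).
Proof. by move=> x y; rewrite eq_sym adj_sym. Qed.

Lemma compl_irrefl (T : finType) (G : sgraph T) :
  irreflexive (fun x y => (x != y) && ~~ G x y).
Proof. by move=> x; rewrite eqxx. Qed.

Definition compl (T : finType) (G : sgraph T) : sgraph T :=
  SGraph (compl_sym G) (compl_irrefl G).

Definition bipartite (T : finType) (G : sgraph T) : Prop :=
  exists A : {set T}, forall x y, G x y -> (x \in A) != (y \in A).

Definition co_bipartite (T : finType) (G : sgraph T) : Prop :=
  bipartite (compl G).

Definition unit_interval (R : realType) (T : finType) (G : sgraph T) : Prop :=
  exists l : T -> R, forall x y,
    G x y <-> x != y /\ `[l x, l x + 1] `&` `[l y, l y + 1] !=set0.

(* [ordS] is the cyclic successor, so the equation says that [f] embeds the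
   cycle on ['I_n] as an induced subgraph. *)
Definition induced_cycle (T : finType) (G : sgraph T) (n : nat)
    (f : 'I_n -> T) : Prop :=
  injective f /\
  forall i j : 'I_n, G (f i) (f j) = (j == ordS i) || (i == ordS j).

Definition chordal (T : finType) (G : sgraph T) : Prop :=
  forall (n : nat) (f : 'I_n -> T), (4 <= n)%N -> ~ induced_cycle G f.

(* The box [0, 2g+1] x [0, 3] x [0, 1] with g disjoint square tunnels
   ]2i+1, 2i+2[ x ]1, 2[ drilled through it in the third direction: a solid
   handlebody with g handles. *)
Definition handlebody (R : realType) (g : nat) : set (R * R * R) :=
  [set p | [/\ 0 <= p.1.1 <= (g.*2.+1)%:R, 0 <= p.1.2 <= 3, 0 <= p.2 <= 1 &
    forall i : nat, (i < g)%N ->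
      ~ ((i.*2.+1)%:R < p.1.1 < (i.*2.+2)%:R /\ 1 < p.1.2 < 2)]].

(* The closed orientable surface of genus g, as the topological boundary of a
   solid handlebody with g handles (a sphere for g = 0). *)
Definition surface (R : realType) (g : nat) : set (R * R * R) :=
  closure (@handlebody R g) `\` interior (@handlebody R g).

Definition is_arc (R : realType) (X : topologicalType) (A : set X) (a b : X) :
    Prop :=
  exists h : R -> X,
    [/\ {within `[0, 1], continuous h}, {in `[0, 1] &, injective h},
        h 0 = a, h 1 = b & h @` `[0, 1] = A].

(* An edge is the two-element set of its ends, so [arc] does not depend on an
   orientation of the edges. *)
Definition embeddable (R : realType) (X : topologicalType) (S : set X)
    (T : finType) (G : sgraph T) : Prop :=
  exists (pos : T -> X) (arc : {set T} -> set X),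
    [/\ injective pos /\ (forall v, S (pos v)),
        forall u v, G u v ->
          is_arc R (arc [set u; v]%SET) (pos u) (pos v),
        forall e, e \in edge_set G -> arc e `<=` S,
        forall e v, e \in edge_set G -> arc e (pos v) -> v \in e &
        forall e f, e \in edge_set G -> f \in edge_set G -> e != f ->
          arc e `&` arc f `<=` range pos].

Definition has_genus (R : realType) (T : finType) (G : sgraph T) (g : nat) :
    Prop :=
  embeddable R (@surface R g) G /\
  forall h : nat, embeddable R (@surface R h) G -> (g <= h)%N.

(* Main.v *)
(* The surface of the handlebody is cut into the cells of the cubic lattice of
   mesh 1/N, N large: the arcs of an embedding of G then become disjoint
   connected sets of lattice points, so G is a subgraph of a quotient W of the
   lattice graph of the surface by a partition into connected sets.

   Let ell be the distance to a root in W. A spanning tree of the lattice graph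
   that leaves each class of the partition only towards a lower layer, and a
   spanning tree of the dual graph avoiding it, leave a set X of edges which has
   size O(g) by Euler's formula (for which toggling the parity of one coordinate
   is an almost perfect matching between edges and the other cells). The bag of a
   face consists of the classes met by the tree paths from its corners and from
   the ends of X to the root; a path meets each layer at most once, so a bag has
   O(g) elements in each layer. The bags containing a class form a subtree of the
   dual tree. Hence two classes adjacent in W share a bag, the graph "sharing a
   bag" is chordal, and within a layer it is O(g)-colourable greedily.

   The chordal graph is this one, the unit interval graph joins the vertices of
   equal or consecutive layers, and there is one co-bipartite graph for each
   binary digit of the pair (parity of the layer, colour): it drops the
   non-edges of G between vertices whose digits differ. *)
Require Import Defs.
From mathcomp Require Import all_boot all_order all_algebra.
From mathcomp Require Import all_classical all_reals all_analysis.
From mathcomp Require Import zify lra fintype finset.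
Import Order.TTheory GRing.Theory Num.Theory numFieldNormedType.Exports.
Set Implicit Arguments.
Unset Strict Implicit.
Unset Printing Implicit Defensive.

(** * Breadth-first distances and greedy colouring *)

Lemma bfs_distance (V : finType) (e : rel V) (r : V) :
  exists d : V -> nat,
    [/\ d r = 0,
        forall x y, connect e r x -> e x y -> d y <= (d x).+1
      & forall x, connect e r x -> x != r ->
          exists y, [/\ connect e r y, e y x & d x = (d y).+1]].
Proof.
pose P x n := [exists p : n.-tuple V, path e r p && (last r p == x)].
have PP x p : path e r p -> last r p = x -> P x (size p).
  by move=> ep lp; apply/existsP; exists (in_tuple p); rewrite /= ep lp eqxx.
have exP x : connect e r x -> exists n, P x n.
  by case/connectP=> p ep ->; exists (size p); apply: PP.
have /fin_all_exists[d dP] : forall x, exists n,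
    connect e r x -> P x n /\ forall m, P x m -> n <= m.
  (* Vertices out of reach of [r] get a junk distance, which is why the clauses on [d] assume
     reachability. *)
  move=> x; case: (boolP (connect e r x)) => [/exP ex|_]; last by exists 0.
  by exists (ex_minn ex) => _; case: ex_minnP.
have step x y : connect e r x -> e x y -> d y <= (d x).+1.
  move=> cx exy; have [/existsP[p /andP[ep /eqP lp]] _] := dP x cx.
  have cy : connect e r y by apply: connect_trans cx (connect1 exy).
  apply: (dP y cy).2.
  rewrite -(size_tuple p) -(size_rcons p y).
  by apply: PP; rewrite ?last_rcons // rcons_path ep lp.
exists d; split=> //.
  by apply/eqP; rewrite -leqn0; apply: (dP r (connect0 _ _)).2; apply: (PP r [::]).
move=> x cx xr; have [/existsP[[p /= sp] /andP[ep /eqP lp]] _] := dP x cx.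
case/lastP: p sp ep lp => [|p z] /=; first by move=> _ _ rx; rewrite rx eqxx in xr.
rewrite size_rcons last_rcons rcons_path => /eqP sp /andP[ep ez] zx.
have cy : connect e r (last r p) by apply/connectP; exists p.
exists (last r p); split=> //; first by rewrite -zx.
apply/eqP; rewrite eqn_leq step //= -?sp ?ltnS; last by rewrite -zx.
by apply: (dP _ cy).2; apply: PP.
Qed.

(** Induction on a set, removing an element of largest key: whatever conflicts with it inside the
    set has no larger key, so fewer than [k] colours are forbidden when it is put back. *)
Lemma greedy_coloring (W : finType) (cf : rel W) (key : W -> nat) (k : nat) :
  symmetric cf ->
  (forall w, #|[set w' | cf w w' & key w' <= key w]| < k) ->
  exists col : W -> 'I_k, forall w w', w != w' -> cf w w' -> col w != col w'.
Proof.
move=> cfC small.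
suff: forall (n : nat) (A : {set W}), #|A| <= n -> exists col : W -> 'I_k,
    {in A &, forall w w', w != w' -> cf w w' -> col w != col w'}.
  by case/(_ #|W| setT (max_card _)) => col colP; exists col => w w'; apply: colP; rewrite inE.
elim=> [|n IHn] A cA.
  case: (posnP k) => [k0|k_gt0].
    have W0 (w : W) : False by have := small w; rewrite k0.
    have /fin_all_exists[col _] : forall w : W, exists i : 'I_k, true by move=> w; case: (W0 w).
    by exists col => w; case: (W0 w).
  exists (fun=> Ordinal k_gt0) => w w'.
  by move: cA; rewrite leqn0 cards_eq0 => /eqP->; rewrite inE.
have [A0|[w0 Aw0]] := set_0Vmem A.
  by apply: IHn; rewrite A0 cards0.
case: (arg_maxnP key Aw0) => w wA wmax; have Aw : w \in A := wA.
have [|col colP] := IHn (A :\ w).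
  by rewrite -ltnS; apply: leq_trans cA; rewrite (cardsD1 w A) Aw add1n.
pose used := [set col w' | w' in [set w' | cf w w' & key w' <= key w]].
have [c cP] : exists c, c \notin used.
  apply/existsP; apply: contraT => /existsPn all.
  have := leq_ltn_trans (leq_imset_card _ _) (small w) : #|used| < k.
  have -> : used = setT by apply/setP=> c; rewrite inE; apply/negbNE/all.
  by rewrite cardsT card_ord ltnn.
have ncol w' : w' \in A -> cf w w' -> c != col w'.
  move=> Aw' cww'; apply: contraNneq cP => ->; apply/imsetP; exists w' => //.
  by rewrite inE cww'; apply: wmax.
exists (fun x => if x == w then c else col x) => x y Ax Ay xy cxy.
have [xw|xw] := eqVneq x w; have [yw|yw] := eqVneq y w.
- by rewrite xw yw eqxx in xy.
- by apply: ncol => //; rewrite -xw.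
- by rewrite eq_sym; apply: ncol => //; rewrite -yw cfC.
- by apply: colP => //; rewrite !inE ?xw ?yw.
Qed.

(** * Rooted trees given by a parent function, and their subtrees *)

Section RootedTree.

Variables (F : finType) (r : F) (par : F -> F) (dep : F -> nat).
Hypothesis dep_par : forall f, f != r -> dep (par f) < dep f.

Definition tree_up : rel F := fun a b => (a != r) && (b == par a).

Definition ancestor : rel F := fun a b => connect tree_up b a.

Lemma ancestorxx a : ancestor a a.
Proof. exact: connect0. Qed.

Lemma ancestor_trans : transitive ancestor.
Proof. by move=> b a c ab bc; apply: connect_trans bc ab. Qed.

Lemma ancestor_par a : a != r -> ancestor (par a) a.
Proof. by move=> ar; apply: connect1; rewrite /tree_up ar eqxx. Qed.

Lemma ancestor_strict a b : ancestor a b -> b != a ->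
  b != r /\ ancestor a (par b).
Proof.
case/connectP=> -[|c p] /=; first by move=> _ ->; rewrite eqxx.
case/andP=> /andP[br /eqP->] pp ->; split=> //.
by apply/connectP; exists p.
Qed.

Lemma ancestor_ind a (P : F -> Prop) : P a ->
  (forall b, b != r -> ancestor a (par b) -> P (par b) -> P b) ->
  forall b, ancestor a b -> P b.
Proof.
move=> Pa IH b; have [n] := ubnP (dep b); elim: n b => // n IHn b bn ab.
have [-> //|ba] := eqVneq b a.
have [br apb] := ancestor_strict ab ba.
by apply: IH => //; apply: IHn => //; apply: leq_trans (dep_par br) _.
Qed.

Lemma ancestor_lt a b : ancestor a b -> b != a -> dep a < dep b.
Proof.
move=> ab; elim/ancestor_ind: b / ab => [|b br _ IH ba]; first by rewrite eqxx.
have [<-|pa] := eqVneq (par b) a; first exact: dep_par.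
exact: ltn_trans (IH pa) (dep_par br).
Qed.

Lemma ancestor_root b : ancestor r b.
Proof.
 have [n] := ubnP (dep b); elim: n b => // n IHn b bn.
have [->|br] := eqVneq b r; first exact: ancestorxx.
apply: ancestor_trans (ancestor_par br).
by apply: IHn; apply: leq_trans (dep_par br) _.
Qed.

(** The ancestors of [c] form a chain from [c] up to the root. *)
Lemma ancestor_total a b c : ancestor a c -> ancestor b c ->
  ancestor a b \/ ancestor b a.
Proof.
move=> ac; elim/ancestor_ind: c / ac => [|c cr apc IH bc]; first by right.
have [<-|cb] := eqVneq c b; last by apply: IH; have [] := ancestor_strict bc cb.
by left; apply: ancestor_trans apc (ancestor_par cr).
Qed.

Definition tree_edge : rel F := fun f f' => tree_up f f' || tree_up f' f.

Definition tree_in (S : {set F}) : rel F :=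
  fun f f' => [&& f \in S, f' \in S & tree_edge f f'].

Lemma tree_in_sym S : symmetric (tree_in S).
Proof. by move=> f f'; rewrite /tree_in /tree_edge orbC andbCA. Qed.

(** Connected sets of nodes, encoded by their node [t] nearest to the root; this form allows
    induction downwards from [t] without speaking of paths. *)
Definition subtree (S : {set F}) (t : F) : Prop :=
  t \in S /\ forall f, f \in S -> f != t -> f != r /\ par f \in S.

Lemma subtree_ind S t (P : F -> Prop) : subtree S t -> P t ->
  (forall f, f != r -> f \in S -> par f \in S -> P (par f) -> P f) ->
  forall f, f \in S -> P f.
Proof.
case=> _ St Pt IH f; have [n] := ubnP (dep f); elim: n f => // n IHn f fn Sf.
have [-> //|ft] := eqVneq f t.
have [fr Spf] := St _ Sf ft.
by apply: IH => //; apply: IHn => //; apply: leq_trans (dep_par fr) _.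
Qed.

Lemma subtree_min S t f : subtree S t -> f \in S -> dep t <= dep f.
Proof.
move=> St Sf; move: f Sf; apply: (subtree_ind St) => // f fr _ _ tf.
exact: leq_trans tf (ltnW (dep_par fr)).
Qed.

(** From a common node [p] one climbs inside [S] up to [t]. On the way [S'] could be left only above
    [t'], but [t'] is no deeper than [t]. *)
Lemma subtree_meet S t S' t' p :
  subtree S t -> subtree S' t' -> dep t' <= dep t -> p \in S -> p \in S' ->
  t \in S'.
Proof.
move=> St St' tt' Sp; move: p Sp; apply: (subtree_ind St) => // p pr Sp Spp IH S'p.
apply: IH; have [] // := St'.2 p S'p.
apply: contraTneq tt' => <-; rewrite -ltnNge.
exact: leq_ltn_trans (subtree_min St Spp) (dep_par pr).
Qed.

(** Take [t] of least depth in [S]. If another [f] in [S] were the root or had its parent outside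
    [S], a path in [S] from [f] could never leave the descendants of [f], so [t] would be strictly
    deeper than [f]. *)
Lemma connected_subtree (S : {set F}) (f0 : F) :
  f0 \in S -> {in S &, forall f f', connect (tree_in S) f f'} ->
  exists t, subtree S t.
Proof.
move=> Sf0 cS; case: (arg_minnP dep Sf0) => t St tmin; exists t; split=> // f Sf ft.
suff: (f != r) && (par f \in S) by case/andP.
apply: contraT => nS.
have DS h h' : tree_in S h h' -> ancestor f h -> ancestor f h'.
  case/and3P=> Sh Sh' /orP[/andP[hr /eqP Eh']|/andP[hr /eqP Eh]] fh.
    have [hf|hf] := eqVneq h f; last by rewrite Eh'; have [] := ancestor_strict fh hf.
    by rewrite -hf hr -Eh' Sh' in nS.
  by apply: ancestor_trans fh _; rewrite Eh; apply: ancestor_par.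
have /connectP[p pp lp] := cS _ _ Sf St.
have /ancestor_lt : ancestor f t.
  have pathP h q : path (tree_in S) h q -> ancestor f h -> ancestor f (last h q).
    by elim: q h => [|h' q IH] h //= /andP[hh' qq] fh; apply: IH qq (DS _ _ hh' fh).
  by rewrite lp; apply: pathP pp (ancestorxx f).
by rewrite eq_sym ft => /(_ isT); rewrite ltnNge tmin.
Qed.

Lemma whole_subtree : subtree [set: F] r.
Proof. by split=> [|f _ fr]; rewrite ?inE. Qed.

Lemma whole_connected f f' : connect (tree_in setT) f f'.
Proof.
have sy := sym_connect_sym (tree_in_sym setT).
suff toR g : connect (tree_in setT) r g by apply: connect_trans (toR f'); rewrite sy.
move: g (in_setT g); apply: (subtree_ind whole_subtree) => [|g gr _ _ IH]; first exact: connect0.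
by apply: connect_trans IH (connect1 _); rewrite /tree_in !inE /tree_edge /tree_up gr eqxx orbT.
Qed.

End RootedTree.

(** Used for the two neighbours [q] and [s (s q)] of [s q] on a cycle: they are distinct and not
    consecutive. *)
Lemma cyclic_succ_neq (n q : nat) (s := fun k => if k.+1 == n then 0 else k.+1) :
  4 <= n -> q < n -> [/\ s (s q) <> q, s (s (s q)) <> q & s q <> s (s q)].
Proof.
rewrite /s => n4 qn; have f1 : (1 == n) = false by lia.
have f2 : (2 == n) = false by lia.
have f3 : (3 == n) = false by lia.
case: (q.+1 =P n) => h1; rewrite ?f1 ?f2 ?f3; first by split; lia.
case: (q.+2 =P n) => h2; rewrite ?f1 ?f2 ?f3; first by split; lia.
by case: (q.+3 =P n) => h3; split; lia.
Qed.

(** Intersection graphs of subtrees of a tree are chordal. On a cycle take the vertex whose subtree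
    has the deepest top; by [subtree_meet] that top lies in the subtrees of both neighbours, which
    are therefore joined by a chord. *)
Lemma subtree_chordal (F W : finType) (r : F) (par : F -> F) (dep : F -> nat)
    (S : W -> {set F}) (t : W -> F) (C : rel W) :
  (forall f, f != r -> dep (par f) < dep f) ->
  (forall w, subtree r par (S w) (t w)) ->
  (forall w w', C w w' = (w != w') && (S w :&: S w' != set0)) ->
  forall (n : nat) (f : 'I_n -> W), 4 <= n ->
  ~ (injective f /\
     forall i j : 'I_n, C (f i) (f j) = (j == ordS i) || (i == ordS j)).
Proof.
move=> dpar St CE n f n4 [finj fC].
have n0 : 0 < n by apply: leq_trans n4.
case: (arg_maxnP (fun i => dep (t (f i))) (erefl : xpredT (Ordinal n0))) => i _ imax.
have meet j : C (f i) (f j) -> t (f i) \in S (f j).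
  rewrite CE => /andP[_ /set0Pn[p /setIP[Sip Sjp]]].
  exact: (subtree_meet dpar (St _) (St _) (imax j isT) Sip Sjp).
have vS (k : 'I_n) : val (ordS k) = if k.+1 == n then 0 else k.+1.
  rewrite /=; case: eqP => [->|/eqP kn]; first by rewrite modnn.
  by rewrite modn_small // ltn_neqAle kn ltn_ord.
have [q iq] : exists q, i = ordS q by exists (ord_pred i); rewrite ord_predK.
have : C (f (ordS i)) (f q).
  rewrite CE (inj_eq finj); apply/andP; split; last first.
    by apply/set0Pn; exists (t (f i)); rewrite inE !meet // fC iq eqxx ?orbT.
  apply/eqP => /(congr1 val); rewrite iq !vS => E.
  by have [] := cyclic_succ_neq n4 (ltn_ord q) => /(_ E).
rewrite fC iq; have [_ n3 n1] := cyclic_succ_neq n4 (ltn_ord q).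
by move=> /orP[] /eqP /(congr1 val); rewrite !vS => /esym.
Qed.

(** * Abstract two-dimensional cell complexes and their layered decomposition *)

Section CellComplex.

Variables (V E F : finType) (iv : V -> E -> bool) (ie : E -> F -> bool).

Definition corner (x : V) (f : F) : bool := [exists e, iv x e && ie e f].

Definition skel : rel V := fun x y => [exists e, iv x e && iv y e].

(** The faces around [x], cut open at [e0]. Around a vertex of a closed surface they form a cycle,
    which stays connected after one cut; this is what [link_connect] asks for. *)
Definition link (x : V) (e0 : E) : rel F :=
  fun f f' => [exists e, [&& e != e0, iv x e, ie e f & ie e f']].

Hypothesis iv2 : forall e, #|[set x | iv x e]| <= 2.
Hypothesis ie2 : forall e, #|[set f | ie e f]| <= 2.
Hypothesis ie_ex : forall e, exists f, ie e f.
Hypothesis corner_ex : forall x, exists f, corner x f.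
Hypothesis ex_corner : forall f, exists x, corner x f.
Hypothesis corner4 : forall f, #|[set x | corner x f]| <= 4.
Hypothesis link_connect : forall x e0 f f',
  corner x f -> corner x f' -> connect (link x e0) f f'.

Lemma two_elements (T : finType) (A : {set T}) a b c :
  #|A| <= 2 -> a \in A -> b \in A -> a != b -> c \in A -> c = a \/ c = b.
Proof.
move=> A2 Aa Ab ab Ac; have [|ca] := eqVneq c a; first by left.
have [|cb] := eqVneq c b; first by right.
suff: 2 < #|A| by rewrite ltnNge A2.
rewrite (cardsD1 a) Aa (cardsD1 b) (cardsD1 c) !inE Ab Ac cb ca eq_sym ab.
by [].
Qed.

Section Link.

Variables (r : V) (pv : V -> V) (pe : V -> E) (h : V -> nat).
Hypothesis pvP : forall x, x != r ->
  [/\ iv x (pe x), iv (pv x) (pe x) & h (pv x) < h x].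

Let h_pv x : x != r -> h (pv x) < h x. Proof. by case/pvP. Qed.

Definition touching (x : V) : {set F} :=
  [set f | [exists y, ancestor r pv x y && corner y f]].

(* Two faces on both sides of a tree edge below [x] are linked around the
   subtree hanging from that edge, which is why the edges [pe z] need not be
   crossed. *)
Lemma touching_connect (R : rel F) (x : V) :
  connect_sym R ->
  (forall y e f f', ancestor r pv x y -> iv y e ->
     (forall z, z != r -> e != pe z) -> ie e f -> ie e f' -> connect R f f') ->
  {in touching x &, forall f f', connect R f f'}.
Proof.
move=> symR; have [n] := ubnP #|[set y | ancestor r pv x y]|.
elim: n x => // n IHn x xn crossR.
have IHz z : z != r -> pv z = x -> {in touching z &, forall f f', connect R f f'}.
  move=> zr pz; have xz : ancestor r pv x z by rewrite -pz; apply: ancestor_par.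
  apply: IHn; last by move=> y e f f' zy; apply: crossR; apply: ancestor_trans xz zy.
  rewrite -ltnS; apply: leq_trans xn; rewrite ltnS; apply: proper_card.
  apply/properP; split.
    by apply/subsetP=> y; rewrite !inE; apply: ancestor_trans.
  exists x; rewrite inE ?ancestorxx //; apply/negP => zx.
  have := h_pv zr; rewrite pz => xz_lt.
  have := ancestor_lt h_pv zx; rewrite -{1}pz.
  have [pzz|_ /(_ isT)] := eqVneq (pv z) z; last by rewrite ltnNge ltnW ?h_pv.
  by rewrite -pz pzz ltnn in xz_lt.
have pe_touch z f : z != r -> ie (pe z) f -> f \in touching z /\ corner (pv z) f.
  move=> zr ezf; have [ze pze _] := pvP zr; rewrite inE; split.
    by apply/existsP; exists z; rewrite ancestorxx; apply/existsP; exists (pe z); rewrite ze.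
  by apply/existsP; exists (pe z); rewrite pze.
(* The link is cut at [pe x]. Any other tree edge at [x] is [pe z] for a child [z] of [x], and the
   faces on its two sides are joined by the induction hypothesis for [z]. *)
have linkR f f' : corner x f -> corner x f' -> connect R f f'.
  move=> xf xf'; have := link_connect (pe x) xf xf'.
  apply: connect_sub => {xf xf'}f {}f' /existsP[e /and4P[epx xe ef ef']].
  have [/existsP[z /andP[zr /eqP ez]]|/existsPn nT] :=
    boolP [exists z, (z != r) && (e == pe z)]; last first.
    apply: (crossR x e) => //; first exact: ancestorxx.
    by move=> z zr; have := nT z; rewrite zr.
  have [ze pze hz] := pvP zr; rewrite {}ez in epx xe ef ef'.
  have zx : z != x by apply: contraNneq epx => ->.
  have pz : pv z = x.
    have zpz : z != pv z by apply: contraTneq hz => <-; rewrite ltnn.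
    have [] // := @two_elements _ [set y | iv y (pe z)] z (pv z) x (iv2 _); rewrite ?inE //.
    by move=> xz; rewrite xz eqxx in zx.
  by apply: (IHz z) => //; [have [] := pe_touch z f zr ef | have [] := pe_touch z f' zr ef'].
(* A face touching a proper descendant [y] of [x] touches the subtree of a child [z]; inside that
   subtree it is joined to a face [f3] at the edge [pe z], which has [x] as a corner. *)
have toX f : f \in touching x -> exists2 f', corner x f' & connect R f f'.
  rewrite inE => /existsP[y /andP[xy yf]].
  have [yx|yx] := eqVneq y x; first by exists f; rewrite -?yx ?connect0.
  have [z [zr pz zy]] : exists z, [/\ z != r, pv z = x & ancestor r pv z y].
    move: yx; elim/(ancestor_ind h_pv): y / xy {yf} => [|y yr xpy IH yx]; first by rewrite eqxx.
    have [pyx|pyx] := eqVneq (pv y) x; first by exists y; rewrite ancestorxx.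
    have [z [zr pz zpy]] := IH pyx; exists z; split=> //.
    exact: ancestor_trans zpy (ancestor_par pv yr).
  have [f3 ef3] := ie_ex (pe z); have [f3z f3x] := pe_touch z f3 zr ef3.
  exists f3; first by rewrite -pz.
  by apply: (IHz z) => //; rewrite inE; apply/existsP; exists y; rewrite zy.
move=> f f' /toX[f1 xf1 ff1] /toX[f2 xf2 ff2].
apply: connect_trans ff1 _; apply: connect_trans (linkR _ _ xf1 xf2) _.
by rewrite symR.
Qed.

End Link.

(** Inside a class the tree is a breadth-first tree towards [top]; from [top] it steps to an
    adjacent vertex of a lower layer. Hence [top] of a class is an ancestor of the whole class. *)
Lemma layered_tree (W : finType) (phi : V -> W) (r : V) :
  (forall x, connect skel r x) ->
  (forall w, exists x, phi x = w) ->
  (forall x y, phi x = phi y ->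
     connect (fun a b => skel a b && (phi a == phi b)) x y) ->
  exists (ell : W -> nat) (top : W -> V) (pv : V -> V) (pe : V -> E) (h : V -> nat),
    [/\ forall x y, skel x y -> ell (phi y) <= (ell (phi x)).+1,
        forall x, x != r -> [/\ iv x (pe x), iv (pv x) (pe x) & h (pv x) < h x],
        forall x, x != r -> phi (pv x) = phi x \/ ell (phi (pv x)) < ell (phi x),
        forall w, phi (top w) = w
      & forall x, ancestor r pv (top (phi x)) x].
Proof.
move=> cV surj cphi.
pose ew w w' := [exists x, exists y, [&& phi x == w, phi y == w' & skel x y]].
have cW x : connect ew (phi r) (phi x).
  have /connectP[p pp ->] := cV x; move: r pp {cV}.
  elim: p => [|y p IH] z /=; first by rewrite connect0.
  case/andP=> zy pp; apply: connect_trans (IH _ pp); apply: connect1.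
  by apply/existsP; exists z; apply/existsP; exists y; rewrite !eqxx.
have [ell [ell0 ell1 ell2]] := bfs_distance ew (phi r).
have ellS x y : skel x y -> ell (phi y) <= (ell (phi x)).+1.
  move=> xy; apply: ell1 => //; apply/existsP; exists x; apply/existsP; exists y.
  by rewrite !eqxx.
pose fib : rel V := fun a b => skel a b && (phi a == phi b).
have /fin_all_exists[top topP] : forall w, exists z, phi z = w /\
    (z = r \/ exists2 y, skel y z & ell (phi y) < ell w).
  move=> w; have [<-|wr] := eqVneq (phi r) w; first by exists r; split=> //; left.
  have [x xw] := surj w; have := ell2 w; rewrite -{1}xw eq_sym wr => /(_ (cW x) isT).
  case=> w' [_ /existsP[y /existsP[z /and3P[/eqP yw' /eqP zw yz]]] lw].
  by exists z; split=> //; right; exists y => //; rewrite yw' lw.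
have /fin_all_exists[d dP] : forall w, exists d : V -> nat,
    [/\ d (top w) = 0,
        forall x y, connect fib (top w) x -> fib x y -> d y <= (d x).+1
      & forall x, connect fib (top w) x -> x != top w ->
          exists y, [/\ connect fib (top w) y, fib y x & d x = (d y).+1]].
  by move=> w; apply: bfs_distance.
(* [B] exceeds every distance inside a class, so the height [h] compares first the layer and then
   the distance to [top]. *)
pose B := (\max_x d (phi x) x).+1.
pose h x := ell (phi x) * B + d (phi x) x.
have dB x : d (phi x) x < B by rewrite ltnS (leq_bigmax x).
have hlt x y : ell (phi y) < ell (phi x) -> h y < h x.
  move=> yx; rewrite /h (@leq_trans ((ell (phi y)).+1 * B)) //.
    by rewrite mulSn addnC ltn_add2r.
  by apply: leq_trans (leq_addr _ _); rewrite leq_mul2r yx orbT.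
have cfib x : connect fib (top (phi x)) x.
  by apply: cphi; case: (topP (phi x)).
have par_ex x : exists p : V * E, x != r ->
    [/\ iv x p.2 && iv p.1 p.2, h p.1 < h x,
        phi p.1 = phi x \/ ell (phi p.1) < ell (phi x)
      & x != top (phi x) -> phi p.1 = phi x].
  have [xr|xr] := eqVneq x r; last first.
    have [xt|xt] := eqVneq x (top (phi x)).
      have [_ [tr|[y yt ly]]] := topP (phi x); first by rewrite xt tr eqxx in xr.
      rewrite -xt in yt; have /existsP[e /andP[ye xe]] := yt; exists (y, e) => _; split=> //=.
      - by rewrite xe ye.
      - exact: hlt.
      - by right.
    have [_ _ /(_ x (cfib x) xt)[y [_ /andP[yx /eqP phiy] dxy]]] := dP (phi x).
    have /existsP[e /andP[ye xe]] := yx; exists (y, e) => _; split=> //=.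
    - by rewrite xe ye.
    - by rewrite /h phiy dxy addnS.
    - by left.
  (* The root gets a dummy parent; [corner_ex] provides an edge to go with it. *)
  have [f /existsP[e _]] := corner_ex x; by exists (x, e); rewrite xr.
have {par_ex}/fin_all_exists[p pP] := par_ex.
exists ell, top, (fun x => (p x).1), (fun x => (p x).2), h; split=> //.
- by move=> x /pP[/andP[]].
- by move=> x /pP[].
- by move=> w; case: (topP w).
move=> x; have [n] := ubnP (h x); elim: n x => // n IHn x hn.
have [tx|xt] := eqVneq x (top (phi x)); first by rewrite -tx; apply: ancestorxx.
have xr : x != r.
  apply: contraNneq xt => xr; have [_ [->|[y _ ly]]] := topP (phi x); first by rewrite xr.
  by rewrite xr ell0 in ly.
have [_ hx _ /(_ xt) px] := pP x xr.
apply: ancestor_trans (ancestor_par _ xr); rewrite -px.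
exact: IHn (leq_trans hx _).
Qed.


(** Two nodes with the same parent edge would be each other's parents, and the height would drop
    both ways. *)
Lemma parent_edges_inj (T D : finType) (inc : T -> D -> bool) (r : T)
    (par : T -> T) (pe : T -> D) (h : T -> nat) :
  (forall e, #|[set x | inc x e]| <= 2) ->
  (forall x, x != r -> [/\ inc x (pe x), inc (par x) (pe x) & h (par x) < h x]) ->
  {in [set~ r] &, injective pe}.
Proof.
move=> inc2 parP x y; rewrite !inE => xr yr exy.
have [xe pxe hx] := parP x xr; have [ye pye hy] := parP y yr.
rewrite -exy in ye pye.
have xpx : x != par x by apply: contraTneq hx => <-; rewrite ltnn.
have ypy : y != par y by apply: contraTneq hy => <-; rewrite ltnn.
have [] := @two_elements _ _ x (par x) y (inc2 (pe x)); rewrite ?inE // => ypx.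
have [] := @two_elements _ _ y (par y) x (inc2 (pe x)); rewrite ?inE // => xpy.
by move: hx hy; rewrite -ypx -xpy => /ltnW; rewrite leqNgt => /negP.
Qed.

(** [m] measures the defect in Euler's formula. The generators of a bag are at most 4 corners and
    the ends of at most [m.+2] edges, whence [m.*2 + 8] classes per layer, and one more colour for
    the greedy colouring. *)
Theorem layered_decomposition (W : finType) (phi : V -> W) (r : V) (m : nat) :
  (forall x, connect skel r x) ->
  (forall w, exists x, phi x = w) ->
  (forall x y, phi x = phi y ->
     connect (fun a b => skel a b && (phi a == phi b)) x y) ->
  #|E| <= #|V| + #|F| + m ->
  exists (ell : W -> nat) (C : rel W) (col : W -> 'I_(m.*2 + 8).+1),
    [/\ symmetric C /\ irreflexive C,
        forall (n : nat) (f : 'I_n -> W), 4 <= n ->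
          ~ (injective f /\
             forall i j : 'I_n, C (f i) (f j) = (j == ordS i) || (i == ordS j)),
        forall x y, skel x y -> phi x != phi y -> C (phi x) (phi y),
        forall x y, skel x y -> ell (phi y) <= (ell (phi x)).+1
      & forall w w', C w w' -> ell w = ell w' -> col w != col w'].
Proof.
move=> cV surj cphi euler.
have [ell [top [pv [pe [h [ellS pvP pvphi topK top_anc]]]]]] := layered_tree cV surj cphi.
have h_pv x : x != r -> h (pv x) < h x by case/pvP.
have [f0 /existsP[e0 _]] := corner_ex r.
pose T := [set pe x | x in [set~ r]].
have notT e : e \notin T -> forall z, z != r -> e != pe z.
  move=> eT z zr; apply: contraNneq eT => ->; apply/imsetP; exists z => //.
  by rewrite !inE.
have inT e : (forall z, z != r -> e != pe z) -> e \notin T.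
  move=> eT; apply/imsetP => -[z]; rewrite !inE => zr ez.
  by have := eT z zr; rewrite ez eqxx.
pose R1 : rel F := fun f f' => [exists e, [&& e \notin T, ie e f & ie e f']].
have R1sym : symmetric R1 by move=> f f'; apply: eq_existsb => e; rewrite [ie e f && _]andbC.
have touch_top f : f \in touching r pv r.
  have [x xf] := ex_corner f; rewrite inE; apply/existsP; exists x.
  by rewrite xf andbT; apply: (ancestor_root h_pv).
(* Every face touches the tree hanging from [r], so [touching_connect] at the root shows that the
   dual graph is connected without crossing tree edges. *)
have cR1 f : connect R1 f0 f.
  apply: (touching_connect pvP (sym_connect_sym R1sym) _ (touch_top _) (touch_top _)).
  move=> y e g g' _ _ /inT eT eg eg'; apply: connect1; apply/existsP; exists e.
  by rewrite eT eg.
have [dep [_ _ dep2]] := bfs_distance R1 f0.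
have /fin_all_exists[p pP] : forall f, exists p : F * E, f != f0 ->
    [/\ p.2 \notin T, ie p.2 f, ie p.2 p.1 & dep p.1 < dep f].
  move=> f; have [->|ff0] := eqVneq f f0.
    by exists (f0, e0).
  have [g [_ /existsP[e /and3P[eT eg ef]] dfg]] := dep2 f (cR1 f) ff0.
  by exists (g, e) => _; rewrite /= dfg.
pose par f := (p f).1; pose ep f := (p f).2.
have dep_par f : f != f0 -> dep (par f) < dep f by case/pP.
pose S := [set ep f | f in [set~ f0]].
pose X := ~: (T :|: S).
(* The two trees use [#|V| - 1] and [#|F| - 1] distinct edges, so the Euler bound leaves at most
   [m + 2]. *)
have cardX : #|X| <= m.+2.
  have cT : #|T| = #|V|.-1 by rewrite card_in_imset ?cardsC1 //; apply: parent_edges_inj iv2 pvP.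
  have cS : #|S| = #|F|.-1.
    rewrite card_in_imset ?cardsC1 //.
    apply: (@parent_edges_inj _ _ (fun f e => ie e f) f0 par ep dep ie2).
    by move=> f /pP[_ ef epf df]; split.
  have TS : T :&: S = set0.
    apply/setP=> e; rewrite !inE; apply/andP => -[eT /imsetP[f]]; rewrite !inE.
    by move=> /pP[eT' _ _ _] ee; rewrite ee (negPf eT') in eT.
  have := cardsC (T :|: S); rewrite -/X cardsU TS cards0 subn0 cT cS.
  have : 0 < #|V| by apply/card_gt0P; exists r.
  have : 0 < #|F| by apply/card_gt0P; exists f0.
  by move: euler; lia.
pose XE := [set x | [exists e in X, iv x e]].
have cardXE : #|XE| <= (m.+2).*2.
  apply: (@leq_trans (\sum_(e in X) #|[set x | iv x e]|)); last first.
    apply: (@leq_trans (\sum_(e in X) 2)); first exact: leq_sum.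
    by rewrite sum_nat_const muln2 leq_double.
  have -> : XE = \bigcup_(e in X) [set x | iv x e].
    apply/setP=> x; apply/idP/bigcupP => [|[e eX xe]]; rewrite inE.
      by case/existsP=> e /andP[eX xe]; exists e => //; rewrite inE.
    by apply/existsP; exists e; rewrite eX; rewrite inE in xe.
  elim/big_rec2: _ => [|e c U _ IH]; first by rewrite cards0.
  by rewrite cardsU; apply: leq_trans (leq_subr _ _) _; rewrite leq_add2l.
pose gens f := [set x | corner x f] :|: XE.
have card_gens f : #|gens f| <= m.*2 + 8.
  rewrite cardsU (leq_trans (leq_subr _ _)) //; have := corner4 f.
  by move: cardXE; lia.
(* The tree path from [x] to the root meets the class [w] exactly when [top w] is an ancestor of
   [x]. *)
pose bag f := [set w | [exists x in gens f, ancestor r pv (top w) x]].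
pose Sw w := [set f | w \in bag f].
have Sw_sub w : touching r pv (top w) \subset Sw w.
  apply/subsetP=> f; rewrite !inE => /existsP[y /andP[wy yf]].
  by apply/existsP; exists y; rewrite !inE yf wy.
(* Either an end of [X] lies below [top w], and then [w] is in every bag; or the bags containing [w]
   are those of the faces touching the subtree of [top w], and [touching_connect] applies. *)
have cSw w : {in Sw w &, forall f f', connect (tree_in f0 par (Sw w)) f f'}.
  have [/existsP[x /andP[xX wx]]|/existsPn noX] :=
    boolP [exists x in XE, ancestor r pv (top w) x].
    have -> : Sw w = setT.
      apply/setP=> f; rewrite !inE; apply/existsP; exists x.
      by rewrite wx andbT in_setU xX orbT.
    by move=> f f' _ _; apply: (whole_connected dep_par).
  have SwE : Sw w = touching r pv (top w).
    apply/eqP; rewrite eqEsubset Sw_sub andbT; apply/subsetP=> f.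
    rewrite !inE => /existsP[x /andP[]]; rewrite in_setU => /orP[xf|xX] wx.
      by rewrite inE in xf; apply/existsP; exists x; rewrite wx.
    by have := noX x; rewrite xX wx.
  rewrite {1}SwE; apply: (touching_connect pvP (sym_connect_sym (tree_in_sym _ _ _))).
  move=> y e f f' wy ye /inT eT ef ef'.
  have [->|ff'] := eqVneq f f'; first exact: connect0.
  (* Otherwise [e] would be in [X], and its end [y] would be an element of [XE] below [top w]. *)
  have eS : e \in S.
    apply: contraT => eS; have := noX y; rewrite wy andbT => /negP[].
    by rewrite inE; apply/existsP; exists e; rewrite ye andbT !inE negb_or eT.
  have touch_e g : ie e g -> g \in Sw w.
    move=> eg; rewrite SwE inE; apply/existsP; exists y; rewrite wy.
    by apply/existsP; exists e; rewrite ye.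
  have /imsetP[g] := eS; rewrite !inE => gf0 eg.
  have [_ ge pge dg] := pP g gf0; rewrite -/(ep g) -eg -/(par g) in ge pge dg.
  have gpg : g != par g by apply: contraTneq dg => <-; rewrite ltnn.
  apply: connect1; rewrite /tree_in !touch_e // /tree_edge /tree_up /=.
  have [] := @two_elements _ _ g (par g) f (ie2 e); rewrite ?inE // => fE.
    have [] := @two_elements _ _ g (par g) f' (ie2 e); rewrite ?inE // => f'E.
      by rewrite fE f'E eqxx in ff'.
    by rewrite fE f'E gf0 eqxx.
  have [] := @two_elements _ _ g (par g) f' (ie2 e); rewrite ?inE // => f'E.
    by rewrite fE f'E gf0 eqxx orbT.
  by rewrite fE f'E eqxx in ff'.
have /fin_all_exists[t tP] : forall w, exists t, subtree f0 par (Sw w) t.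
  move=> w; have [f wf] := corner_ex (top w).
  apply: (connected_subtree dep_par _ (cSw w)); apply: (subsetP (Sw_sub w)); rewrite inE.
  by apply/existsP; exists (top w); rewrite ancestorxx; apply: wf.
pose C : rel W := fun w w' => (w != w') && (Sw w :&: Sw w' != set0).
have Csym : symmetric C by move=> w w'; rewrite /C eq_sym setIC.
pose cf : rel W := fun w w' => C w w' && (ell w == ell w').
have ell_anc x y : ancestor r pv x y -> phi x = phi y \/ ell (phi x) < ell (phi y).
  move=> xy; elim/(ancestor_ind h_pv): y / xy => [|y yr _ IH]; first by left.
  have [<- //|pl] := pvphi y yr; right.
  by case: IH => [->//|lt]; apply: ltn_trans lt pl.
(* Classes of one layer inject into the generators: if two tops are ancestors of the same generator,
   one is an ancestor of the other, and by [ell_anc] distinct classes would have different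
   layers. *)
have layer_bag f l : #|[set w in bag f | ell w == l]| <= m.*2 + 8.
  apply: leq_trans (card_gens f).
  have /fin_all_exists[g gP] : forall w, exists x, w \in bag f ->
      (x \in gens f) && ancestor r pv (top w) x.
    move=> w; have [wf|wf] := boolP (w \in bag f); last by exists r.
    by move: (wf); rewrite inE => /existsP[x xP]; exists x.
  rewrite -(@card_in_imset _ _ g).
    apply: subset_leq_card; apply/subsetP=> _ /imsetP[w wb ->].
    by move: wb; rewrite inE => /andP[/gP/andP[]].
  move=> w w' /setIdP[/gP/andP[_ wg] /eqP wl] /setIdP[/gP/andP[_ wg'] /eqP wl'] gg.
  rewrite -gg in wg'.
  have [/ell_anc|/ell_anc] := ancestor_total h_pv wg wg'; rewrite !topK wl wl' ltnn;
    by case.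
(* By [subtree_meet] a class that conflicts with [w] and whose top face is no deeper contains [t w],
   hence lies in the bag of that one face. *)
have small w : #|[set w' | cf w w' & dep (t w') <= dep (t w)]| < (m.*2 + 8).+1.
  rewrite ltnS; apply: leq_trans (layer_bag (t w) (ell w)).
  apply: subset_leq_card; apply/subsetP=> w'; rewrite !inE.
  case/andP=> /andP[/andP[_ /set0Pn[q /setIP[qw qw']]] /eqP->] le; rewrite eqxx andbT.
  have := subtree_meet dep_par (tP w) (tP w') le qw qw'.
  by rewrite !inE.
have [|col colP] := greedy_coloring _ small.
  by move=> w w'; rewrite /cf Csym eq_sym.
exists ell, C, col; split=> //.
- by split=> // w; rewrite /C eqxx.
- exact: (subtree_chordal dep_par tP).
- move=> x y /existsP[e /andP[xe ye]] xy; rewrite /C xy.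
  have [f ef] := ie_ex e; apply/set0Pn; exists f.
  rewrite inE !(subsetP (Sw_sub _)) // inE; apply/existsP.
    by exists y; rewrite top_anc; apply/existsP; exists e; rewrite ye.
  by exists x; rewrite top_anc; apply/existsP; exists e; rewrite xe.
- move=> w w' Cww' /eqP lww'; apply: colP; last by rewrite /cf Cww'.
  by case/andP: Cww'.
Qed.

End CellComplex.

(** * The cubical subdivision of the surface and its vertex stars *)

(* The position of an open cell of the subdivided line relative to the planes
   [0, 1, ..., 2g+1]: a wall is one of [1, ..., 2g], and a tunnel is one of the
   intervals ]1, 2[, ]3, 4[, ..., ]2g-1, 2g[. *)
Inductive position := Out | Border | Wall | Tunnel | Solid.

Definition is_out t := if t is Out then true else false.
Definition is_border t := if t is Border then true else false.
Definition is_tunnel t := if t is Tunnel then true else false.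
Definition in_tunnel t := match t with Wall | Tunnel => true | _ => false end.

(** As [t1] and [t2] are not both [Tunnel], the last alternative describes a cell on the side wall
    of a tunnel. *)
Definition on_surface (t1 t2 t3 : position) : bool :=
  [&& ~~ [|| is_out t1, is_out t2 | is_out t3],
      ~~ (is_tunnel t1 && is_tunnel t2) &
      [|| is_border t1, is_border t2, is_border t3 | in_tunnel t1 && in_tunnel t2]].

(* The even number [2k] stands for the point [k / N - 1] and the odd number
   [2k+1] for the open interval between [k / N - 1] and [(k+1) / N - 1]; the
   shift by one unit keeps the neighbours of the box in the natural numbers. *)
Definition position_of (N g a : nat) : position :=
  let q := a %/ N.*2 in
  if a %% N.*2 == 0 then
    if (q == 0) || (g.*2.+2 < q) then Out
    else if (q == 1) || (q == g.*2.+2) then Border else Wall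
  else if (q == 0) || (g.*2.+2 <= q) then Out
  else if odd q then Solid else Tunnel.

Definition triple := (nat * nat * nat)%type.

Definition cell_dim (c : triple) : nat := odd c.1.1 + odd c.1.2 + odd c.2.

Definition face1 (a b : nat) : bool :=
  (a == b) || odd b && ((a.+1 == b) || (a == b.+1)).

Definition face_of (c d : triple) : bool :=
  [&& face1 c.1.1 d.1.1, face1 c.1.2 d.1.2 & face1 c.2 d.2].

Definition surface_cell (N g : nat) (c : triple) : bool :=
  on_surface (position_of N g c.1.1) (position_of N 1 c.1.2) (position_of N 0 c.2).

Lemma face_refl c : face_of c c.
Proof. by rewrite /face_of /face1 !eqxx. Qed.

Lemma face1_trans a b c : face1 a b -> face1 b c -> face1 a c.
Proof. rewrite /face1; lia. Qed.

Lemma face_trans c d e : face_of c d -> face_of d e -> face_of c e.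
Proof.
case/and3P=> c1 c2 c3 /and3P[d1 d2 d3]; apply/and3P.
by split; [apply: face1_trans c1 d1|apply: face1_trans c2 d2|apply: face1_trans c3 d3].
Qed.

(** The positions [t] open to a face of a cell at position [t']: an open interval may give way to
    one of its end planes, and [Out] to anything. *)
Definition refines t t' := match t, t' with
  | _, Out | Border, Border | Wall, Wall | Tunnel, Tunnel | Solid, Solid

  | Border, Solid | Wall, Solid | Wall, Tunnel => true | _, _ => false end.

Lemma position_interval N g q k : 0 < k < N.*2 ->
  position_of N g (q * N.*2 + k) =
    if (q == 0) || (g.*2.+2 <= q) then Out else if odd q then Solid else Tunnel.
Proof.
move=> /andP[k0 kN]; have N0 : 0 < N.*2 by apply: leq_trans kN.
by rewrite /position_of divnMDl // modnMDl divn_small // modn_small // addn0 gtn_eqF.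
Qed.

Lemma position_plane N g q : 0 < N ->
  position_of N g (q * N.*2) =
    if (q == 0) || (g.*2.+2 < q) then Out
    else if (q == 1) || (q == g.*2.+2) then Border else Wall.
Proof. by move=> N0; rewrite /position_of modnMl eqxx mulnK // double_gt0. Qed.

(** Positions just below, at and just above an even coordinate. The list depends on neither [N] nor
    [g], so the neighbourhood of a lattice point reduces to [7 ^ 3] cases. *)
Definition patterns : seq (seq position) :=
  [:: [:: Out; Out; Out]; [:: Out; Border; Solid]; [:: Solid; Border; Out];
      [:: Solid; Solid; Solid]; [:: Tunnel; Tunnel; Tunnel];
      [:: Solid; Wall; Tunnel]; [:: Tunnel; Wall; Solid]].

Definition pick_pos (p : seq position) (a : nat) := nth Out p a.-1.

Lemma parity_split N a : 0 < N ->
  exists q k, [/\ a = q * N.*2 + k, odd k = odd a & k < N.*2].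
Proof.
move=> N0; exists (a %/ N.*2), (a %% N.*2).
rewrite -divn_eq ltn_pmod ?double_gt0 //; split=> //.
by rewrite {2}(divn_eq a N.*2) oddD oddM odd_double andbF.
Qed.

Lemma position_face N g a b : 0 < N -> face1 a b ->
  refines (position_of N g a) (position_of N g b).
Proof.
move=> N0 /orP[/eqP->|/andP[ob ab]]; first by case: position_of.
have [q [k [bE ok kN]]] := parity_split b N0; rewrite ob in ok.
have k0 : 0 < k by case: (k) ok.
have pb : position_of N g b =
    if (q == 0) || (g.*2.+2 <= q) then Out else if odd q then Solid else Tunnel.
  by rewrite bE position_interval // k0.
have [->|[->|[kr [-> kr0]]]] : a = q * N.*2 \/ a = q.+1 * N.*2 \/
    exists k', a = q * N.*2 + k' /\ 0 < k' < N.*2.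
- move: ab; rewrite bE => /orP[/eqP ab|/eqP ab].
    have [k1|k1] := eqVneq k 1; first by left; lia.
    by right; right; exists k.-1; lia.
  have [k1|k1] := eqVneq k.+1 N.*2; first by right; left; rewrite mulSn; lia.
  by right; right; exists k.+1; lia.
- by rewrite pb position_plane //; do !case: ifP => //=; lia.
- by rewrite pb position_plane //; do !case: ifP => //=; lia.
by rewrite pb position_interval //; case: ifP => //; case: ifP.
Qed.

Lemma on_surface_refines t1 t2 t3 t1' t2' t3' :
  refines t1 t1' -> refines t2 t2' -> refines t3 t3' ->
  on_surface t1' t2' t3' -> on_surface t1 t2 t3.
Proof. by case: t1 t1' => -[] // _; case: t2 t2' => -[] // _; case: t3 t3' => -[]. Qed.

Lemma surface_face N g c d : 0 < N -> face_of c d ->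
  surface_cell N g d -> surface_cell N g c.
Proof.
move=> N0 /and3P[f1 f2 f3]; apply: on_surface_refines; exact: position_face.
Qed.

Lemma position_pattern N g a : 0 < N -> 2 <= a -> ~~ odd a ->
  exists2 i, i < size patterns &
    forall l, 1 <= l <= 3 ->
      position_of N g (a - 2 + l) = pick_pos (nth [::] patterns i) l.
Proof.
move=> N0 a2 ea; have [q [k [aE ek kN]]] := parity_split a N0; rewrite -ek in ea.
have shift l b : a - 2 + l = b -> position_of N g (a - 2 + l) = position_of N g b by move->.
have [k0|k0] := posnP k.
  rewrite k0 addn0 in aE; have q0 : 0 < q by rewrite lt0n; apply: contraTneq a2 => q0; rewrite aE q0.
  have P1 : position_of N g (a - 2 + 1) =
      if (q.-1 == 0) || (g.*2.+2 <= q.-1) then Out else if odd q.-1 then Solid else Tunnel.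
    rewrite (shift _ (q.-1 * N.*2 + N.*2.-1)) ?position_interval //; first by lia.
    by case: q q0 aE {shift} => //= q _ ->; rewrite mulSn; lia.
  have P2 : position_of N g (a - 2 + 2) = if (q == 0) || (g.*2.+2 < q) then Out
    else if (q == 1) || (q == g.*2.+2) then Border else Wall.
    by rewrite (shift _ (q * N.*2)) ?position_plane //; lia.
  have P3 : position_of N g (a - 2 + 3) =
      if (q == 0) || (g.*2.+2 <= q) then Out else if odd q then Solid else Tunnel.
    by rewrite (shift _ (q * N.*2 + 1)) ?position_interval //; lia.
  have [qg|qg] := ltnP g.*2.+2 q; last have [q1|q1] := eqVneq q 1;
    last have [q2|q2] := eqVneq q g.*2.+2; last have [oq|oq] := boolP (odd q).
  - by exists 0 => // -[|[|[|[|]]]] // _; rewrite ?P1 ?P2 ?P3 /=; do !case: ifP => //=; lia.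
  - by exists 1 => // -[|[|[|[|]]]] // _; rewrite ?P1 ?P2 ?P3 /=; do !case: ifP => //=; lia.
  - by exists 2 => // -[|[|[|[|]]]] // _; rewrite ?P1 ?P2 ?P3 /=; do !case: ifP => //=; lia.
  - by exists 6 => // -[|[|[|[|]]]] // _; rewrite ?P1 ?P2 ?P3 /=; do !case: ifP => //=; lia.
  - by exists 5 => // -[|[|[|[|]]]] // _; rewrite ?P1 ?P2 ?P3 /=; do !case: ifP => //=; lia.
have Pl l : 1 <= l <= 3 -> position_of N g (a - 2 + l) =
    if (q == 0) || (g.*2.+2 <= q) then Out else if odd q then Solid else Tunnel.
  by move=> l3; rewrite (shift _ (q * N.*2 + (k - 2 + l))) ?position_interval //; lia.
exists (if (q == 0) || (g.*2.+2 <= q) then 0 else if odd q then 3 else 4).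
  by do !case: ifP.
by case=> [|[|[|[|]]]] // /Pl ->; do !case: ifP.
Qed.

(* The cells around a vertex, translated so that the vertex is [(2, 2, 2)]. *)
Definition local_cells : seq triple :=
  [seq (ab, c) | ab <- [seq (a, b) | a <- [:: 1; 2; 3], b <- [:: 1; 2; 3]],
                 c <- [:: 1; 2; 3]].

Section LocalCheck.

Variables (p1 p2 p3 : seq position).

Definition local_surface (l : triple) :=
  on_surface (pick_pos p1 l.1.1) (pick_pos p2 l.1.2) (pick_pos p3 l.2).

Definition local_star := [seq l <- local_cells | local_surface l].

End LocalCheck.

Section LinkCheck.

Variables (es fs : seq triple) (e0 : triple).

Definition local_linked (f f' : triple) :=
  has (fun e => [&& e != e0, face_of e f & face_of e f']) es.

Definition grow (l : seq triple) :=
  [seq f <- fs | (f \in l) || has (fun f' => local_linked f' f) l].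

(** Six rounds of growth are enough for all the stars that occur, as the computation in
    [all_stars_ok] confirms. *)
Definition link_ok : bool :=
  if fs is f :: _ then all (mem (iter 6 grow [:: f])) fs else true.

End LinkCheck.

(** The test that a vertex star looks like that of a closed surface. In the last clause [(2, 2, 2)]
    is not an edge and stands for the uncut link; a star whose centre is off the surface passes. *)
Definition star_ok_in (S : seq triple) : bool :=
  let es := [seq l <- S | cell_dim l == 1] in
  let fs := [seq l <- S | cell_dim l == 2] in
  ((2, 2, 2) \in S) ==>
  [&& all (fun l => cell_dim l <= 2) S,
      has (fun e => has (face_of e) fs) es,
      all (fun e => 0 < count (face_of e) fs <= 2) es
    & all (link_ok es fs) ((2, 2, 2) :: es)].

Definition star_ok p1 p2 p3 := star_ok_in (local_star p1 p2 p3).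

Lemma all_stars_ok :
  all (fun p1 => all (fun p2 => all (star_ok p1 p2) patterns) patterns) patterns.
Proof. by vm_compute. Qed.

Lemma position_bound N g a : 0 < N -> ~~ is_out (position_of N g a) ->
  2 <= a < (g.*2 + 3) * N.*2.
Proof.
move=> N0; have D0 : 0 < N.*2 by rewrite double_gt0.
have := divn_eq a N.*2; have := ltn_pmod a D0.
rewrite /position_of; set q := a %/ _; set k := a %% _ => kD ->.
case: ifP => _; first case: ifP => // /norP[q0 qg].
  by rewrite -leqNgt in qg => _; nia.
case: ifP => // /norP[q0 qg]; rewrite -ltnNge in qg.
by case: ifP => _ _; nia.
Qed.

Lemma surface_bound N g c : 0 < N -> surface_cell N g c ->
  [/\ 2 <= c.1.1 < (g.*2 + 3) * N.*2, 2 <= c.1.2 < 5 * N.*2 & 2 <= c.2 < 3 * N.*2].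
Proof.
move=> N0 /and3P[/norP[ o1 /norP[ o2 o3]] _ _].
have := position_bound N0 o1; have := position_bound N0 o2.
by have := position_bound N0 o3.
Qed.

(** The expression is [v - u + 2] in truncated arithmetic: at most one of the two differences is
    nonzero. *)
Lemma face1_digit u v : 2 <= u -> face1 u v ->
  v - u + 2 - (u - v) \in [:: 1; 2; 3] /\ u - 2 + (v - u + 2 - (u - v)) = v.
Proof. by rewrite !inE /face1; lia. Qed.

(** The star of [x] is a translate of a local star, since the positions around [x] follow one
    pattern in each coordinate. The finite check [all_stars_ok] thus holds at every vertex. *)
Lemma surface_star N g (x : triple) : 0 < N ->
  surface_cell N g x -> cell_dim x = 0 ->
  exists (S : seq triple) (tr : triple -> triple),
    [/\ star_ok_in S /\ injective tr, (2, 2, 2) \in S /\ tr (2, 2, 2) = x,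
        forall c, surface_cell N g c -> face_of x c -> exists2 l, l \in S & c = tr l,
        forall l, l \in S ->
          [/\ surface_cell N g (tr l), cell_dim (tr l) = cell_dim l & face_of x (tr l)]
      & {in S &, forall l l', face_of (tr l) (tr l') = face_of l l'}].
Proof.
case: x => [[x1 x2] x3] N0 xS dx; have [b1 b2 b3] := surface_bound N0 xS.
rewrite /= in b1 b2 b3.
have /and3P[e1 e2 e3] : [&& ~~ odd x1, ~~ odd x2 & ~~ odd x3].
  by move: dx; rewrite /cell_dim /=; case: odd; case: odd; case: odd.
have g1 : 2 <= x1 by case/andP: b1.
have g2 : 2 <= x2 by case/andP: b2.
have g3 : 2 <= x3 by case/andP: b3.
have [i1 i1P P1] := position_pattern g N0 g1 e1.
have [i2 i2P P2] := position_pattern 1 N0 g2 e2.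
have [i3 i3P P3] := position_pattern 0 N0 g3 e3.
pose S := local_star (nth [::] patterns i1) (nth [::] patterns i2) (nth [::] patterns i3).
pose tr (l : triple) : triple := (x1 - 2 + l.1.1, x2 - 2 + l.1.2, x3 - 2 + l.2).
have locP l : l \in local_cells -> [/\ 1 <= l.1.1 <= 3, 1 <= l.1.2 <= 3 & 1 <= l.2 <= 3].
  have : all (fun l => [&& 1 <= l.1.1 <= 3, 1 <= l.1.2 <= 3 & 1 <= l.2 <= 3]) local_cells by [].
  by move=> /allP H /H /and3P[].
have trS l : l \in local_cells -> (l \in S) = surface_cell N g (tr l).
  move=> lL; have [l1 l2 l3] := locP l lL.
  by rewrite mem_filter lL andbT /surface_cell /local_surface /= P1 // P2 // P3.
have tr2 : tr (2, 2, 2) = (x1, x2, x3) by rewrite /tr /= !subnK.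
have S2 : (2, 2, 2) \in S by rewrite trS // tr2.
have face_tr l l' : face_of (tr l) (tr l') = face_of l l'.
  have F u a b : ~~ odd u -> face1 (u - 2 + a) (u - 2 + b) = face1 a b.
    by rewrite /face1; lia.
  by rewrite /face_of /= !F.
have face2 l : l \in local_cells -> face_of (2, 2, 2) l.
  have : all (face_of (2, 2, 2)) local_cells by [].
  by move=> /allP; apply.
exists S, tr; split=> //.
- split; last first.
    by case=> [[a b] c] [[a' b'] c'] [/addnI-> /addnI-> /addnI->].
  have /all_nthP - /(_ [::] i1 i1P) := all_stars_ok.
  by move=> /all_nthP - /(_ [::] i2 i2P) /all_nthP - /(_ [::] i3 i3P).
- case=> [[a b] c] cS xc.
  have /and3P[/= f1 f2 f3] := xc.
  have lL : (a - x1 + 2 - (x1 - a), b - x2 + 2 - (x2 - b), c - x3 + 2 - (x3 - c)) \in local_cells.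
    by apply: allpairs_f; [apply: allpairs_f|]; apply: proj1 (face1_digit _ _).
  have E : (a, b, c) = tr (a - x1 + 2 - (x1 - a), b - x2 + 2 - (x2 - b), c - x3 + 2 - (x3 - c)).
    by rewrite /tr /= !(proj2 (face1_digit _ _)).
  by eexists; last exact: E; rewrite trS // -E.
- move=> l lS; have lL : l \in local_cells by move: lS; rewrite mem_filter => /andP[].
  split; first by rewrite -trS.
    by rewrite /cell_dim /= !oddD !oddB // (negPf e1) (negPf e2) (negPf e3).
  by rewrite -tr2 face_tr face2.
Qed.

(** * Corners of cells, and the matching between edges and the other cells *)

Definition vertices1 (a : nat) : seq nat := if odd a then [:: a.-1; a.+1] else [:: a].

Definition triples (s1 s2 s3 : seq nat) : seq triple :=
  [seq (ab, c) | ab <- [seq (a, b) | a <- s1, b <- s2], c <- s3].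

Lemma mem_triples s1 s2 s3 (c : triple) :
  (c \in triples s1 s2 s3) = [&& c.1.1 \in s1, c.1.2 \in s2 & c.2 \in s3].
Proof.
case: c => [[a b] c]; apply/allpairsP/and3P => /= [ [ [u v] /= [uI vI [E ->] ] ]|].
  by move: uI; rewrite -E => /allpairsP[ [u1 u2] /= [? ? [-> ->] ] ].
by case=> a1 b2 c3; exists ((a, b), c); split=> //; apply: allpairs_f.
Qed.

Lemma size_triples s1 s2 s3 : size (triples s1 s2 s3) = size s1 * size s2 * size s3.
Proof. by rewrite !size_allpairs. Qed.

Lemma card_le_size (T : finType) (U : eqType) (v : T -> U) (A : {set T}) (s : seq U) :
  injective v -> (forall x, x \in A -> v x \in s) -> #|A| <= size s.
Proof.
move=> vI As; rewrite cardE -(size_map v); apply: uniq_leq_size.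
  by rewrite map_inj_uniq ?enum_uniq.
by move=> _ /mapP[x xA ->]; apply: As; rewrite mem_enum in xA.
Qed.

Lemma face_dim0 c d : cell_dim c = 0 -> face_of c d ->
  c \in triples (vertices1 d.1.1) (vertices1 d.1.2) (vertices1 d.2).
Proof.
case: c d => [[c1 c2] c3] [[d1 d2] d3].
rewrite /cell_dim /= => dc /and3P[/= f1 f2 f3]; rewrite mem_triples /=.
have F a b : ~~ odd a -> face1 a b -> a \in vertices1 b.
  by rewrite /face1 /vertices1; case: ifP; rewrite !inE; lia.
by rewrite !F //; move: dc; case: odd; case: odd; case: odd.
Qed.

Lemma size_vertices d :
  size (triples (vertices1 d.1.1) (vertices1 d.1.2) (vertices1 d.2)) = 2 ^ cell_dim d.
Proof.
rewrite size_triples /vertices1 /cell_dim.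
by case: odd; case: odd; case: odd.
Qed.

Lemma boundary_cell c : 0 < cell_dim c ->
  exists2 d, face_of d c & (cell_dim d).+1 = cell_dim c.
Proof.
case: c => [[a b] c]; rewrite /cell_dim /=.
have [ oa|ea] := boolP (odd a).
  by exists (a.+1, b, c); rewrite /face_of /face1 /cell_dim /= ?oa ?eqxx ?orbT.
have [ ob|eb] := boolP (odd b).
  by exists (a, b.+1, c); rewrite /face_of /face1 /cell_dim /= ?ob ?(negPf ea) ?eqxx ?orbT.
have [ oc|//] := boolP (odd c).
by exists (a, b, c.+1); rewrite /face_of /face1 /cell_dim /= ?oc ?(negPf ea) ?(negPf eb) ?eqxx ?orbT.
Qed.

Lemma has_vertex c : exists2 x, face_of x c & cell_dim x = 0.
Proof.
move: {2}(cell_dim c) (erefl (cell_dim c)) => n; elim: n c => [|n IH] c dc.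
  by exists c => //; apply: face_refl.
have [|d dc' dd] := @boundary_cell c; first by rewrite dc.
have [|x xd x0] := IH d; first by apply: succn_inj; rewrite dd.
by exists x => //; apply: face_trans xd dc'.
Qed.

Section Toggle.

Variable N : nat.
Hypothesis N0 : 0 < N.

(* Pairs the odd position [a] with the even position [a.+1] inside each unit
   interval; the walls and the last odd position of each interval are left. *)
Definition special (a : nat) : bool :=
  (a %% N.*2 == 0) || ((a %% N.*2).+1 == N.*2).

Definition toggle1 (a : nat) : nat := if odd a then a.+1 else a.-1.

Definition toggle (c : triple) : triple :=
  if ~~ special c.1.1 then (toggle1 c.1.1, c.1.2, c.2)
  else if ~~ special c.1.2 then (c.1.1, toggle1 c.1.2, c.2)
  else (c.1.1, c.1.2, toggle1 c.2).

Definition all_special (c : triple) : bool :=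
  [&& special c.1.1, special c.1.2 & special c.2].

Lemma toggle1_spec g a : ~~ special a ->
  [/\ ~~ special (toggle1 a), toggle1 (toggle1 a) = a,
      position_of N g (toggle1 a) = position_of N g a,
      odd (toggle1 a) = ~~ odd a
    & face1 a (toggle1 a) || face1 (toggle1 a) a].
Proof.
rewrite /special => /norP[a0 a1].
have D0 : 0 < N.*2 by rewrite double_gt0.
have a_gt0 : 0 < a by rewrite lt0n; apply: contraNneq a0 => ->; rewrite mod0n.
have kD := ltn_pmod a D0; have aE := divn_eq a N.*2.
set q := a %/ N.*2 in aE *; set k := a %% N.*2 in a0 a1 kD aE *.
have ok : odd a = odd k by rewrite aE oddD oddM odd_double andbF.
pose k' := if odd k then k.+1 else k.-1.
have k'D : 0 < k' < N.*2 by rewrite /k'; case: ifP => o; lia.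
have tE : toggle1 a = q * N.*2 + k'.
  by rewrite /toggle1 ok /k' aE; case: ifP => _; lia.
have tk : toggle1 a %% N.*2 = k' by rewrite tE modnMDl modn_small //; case/andP: k'D.
split.
- by rewrite tk /k'; case: ifP => o; lia.
- rewrite /toggle1; have [ o|o] := boolP (odd a); first by rewrite /= o.
  by rewrite (_ : odd a.-1) ?prednK //; lia.
- by rewrite tE position_interval // [in RHS]aE position_interval // kD lt0n a0.
- by rewrite /toggle1; case: ifP => o /=; lia.
- by rewrite /face1 /toggle1; case: ifP => o /=; lia.
Qed.

(** A toggled coordinate stays non-special, so a second toggle picks the same coordinate and undoes
    the first. It also stays in its open unit interval, so the position is unchanged. *)
Lemma toggle_spec g c : ~~ all_special c ->
  [/\ ~~ all_special (toggle c), toggle (toggle c) = c,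
      surface_cell N g (toggle c) = surface_cell N g c,
      odd (cell_dim (toggle c)) = ~~ odd (cell_dim c)
    & face_of c (toggle c) || face_of (toggle c) c].
Proof.
case: c => [[a b] c]; rewrite /all_special /toggle /surface_cell /cell_dim /face_of /=.
have [sa|nsa] := boolP (special a); last first.
  have [s1 tt p o f] := toggle1_spec g nsa => _.
  rewrite /= ?(negPf s1) tt p /=; split=> //; first by rewrite !oddD !oddb o; do 3!case: odd.
  by rewrite /face1 !eqxx /= !andbT.
have [sb|nsb] := boolP (special b); last first.
  have [s1 tt p o f] := toggle1_spec 1 nsb => _.
  rewrite /= sa ?(negPf s1) tt p /=; split=> //; first by rewrite !oddD !oddb o; do 3!case: odd.
  by rewrite /face1 !eqxx /= !andbT.
have [sc|nsc] := boolP (special c) => // _.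
have [s1 tt p o f] := toggle1_spec 0 nsc.
rewrite /= sa sb ?(negPf s1) tt p /=; split=> //; first by rewrite !oddD !oddb o; do 3!case: odd.
by rewrite /face1 !eqxx.
Qed.

Lemma special_bound g a : a < (g.*2 + 3) * N.*2 -> special a ->
  a \in [seq q * N.*2 | q <- iota 0 (g.*2 + 3)] ++
        [seq q * N.*2 + N.*2.-1 | q <- iota 0 (g.*2 + 3)].
Proof.
move=> ab; have D0 : 0 < N.*2 by rewrite lt0n; apply: contraTneq ab => ->; rewrite muln0.
have qb : a %/ N.*2 \in iota 0 (g.*2 + 3) by rewrite mem_iota /= ltn_divLR.
rewrite mem_cat => /orP[/eqP k|/eqP k]; apply/orP; [left|right]; apply/mapP;
  exists (a %/ N.*2) => //; rewrite [LHS](divn_eq a N.*2); first by rewrite k addn0.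
by congr addn; apply: succn_inj; rewrite k prednK.
Qed.

End Toggle.

(** * The finite lattice graph of the surface *)

Lemma connect_lift (K : finType) (P : pred K) (R : rel K) (Q : rel {x | P x}) :
  (forall (a : {x | P x}) (b : K), R (val a) b ->
     exists2 b' : {x | P x}, val b' = b & connect Q a b') ->
  forall a b : {x | P x}, connect R (val a) (val b) -> connect Q a b.
Proof.
move=> lift a b /connectP[p]; elim: p a => [|c p IH] a /=.
  by move=> _ /val_inj->; apply: connect0.
move=> /andP[/lift[c' <- ac'] pp] lp; exact: connect_trans ac' (IH _ pp lp).
Qed.

Lemma face1_even_eq a b d :
  face1 a d -> face1 b d -> ~~ odd a -> ~~ odd b -> a = b \/ odd d.
Proof. by rewrite /face1; lia. Qed.

(** The ranges are those of [surface_bound], so all surface cells are listed and form a finite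
    type. *)
Definition surface_cells (N g : nat) : seq triple :=
  [seq c <- triples (iota 0 ((g.*2 + 3) * N.*2)) (iota 0 (5 * N.*2)) (iota 0 (3 * N.*2))
     | surface_cell N g c].

Definition cell (N g : nat) : finType := seq_sub (surface_cells N g).

Section Grid.

Variables (N g : nat).
Hypothesis N0 : 0 < N.

Notation K := (cell N g).

Lemma cellP (x : K) : surface_cell N g (val x).
Proof. by have := valP x; rewrite mem_filter => /andP[]. Qed.

Lemma cell_ex (c : triple) : surface_cell N g c -> exists x : K, val x = c.
Proof.
move=> cS; have cm : c \in surface_cells N g.
  rewrite mem_filter cS mem_triples !mem_iota /=.
  by have [/andP[_ ->] /andP[_ ->] /andP[_ ->]] := surface_bound N0 cS.
by exists (SeqSub cm).
Qed.

Lemma boundary_cell_ex (y : K) (c : triple) :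
  face_of c (val y) -> exists x : K, val x = c.
Proof. by move=> cy; apply: cell_ex; apply: surface_face cy (cellP y). Qed.

Definition grid_adj : rel K := fun a b =>
  [&& cell_dim (val a) == 0, cell_dim (val b) == 0 &
      [exists e : K, [&& cell_dim (val e) == 1, face_of (val a) (val e) & face_of (val b) (val e)]]].

Lemma grid_adj_sym : symmetric grid_adj.
Proof.
move=> a b; rewrite /grid_adj andbCA; do 2!congr andb.
by apply: eq_existsb => e; rewrite [face_of _ _ && _]andbC.
Qed.

(** Pass from [v] to [w] one coordinate at a time: [x] has the first coordinate of [w], and [y] the
    first two. Where a coordinate changes, that of [c] is odd, and the connecting edge takes it from
    [c]. *)
Lemma corners_connect (v w c : K) :
  cell_dim (val v) = 0 -> cell_dim (val w) = 0 ->
  face_of (val v) (val c) -> face_of (val w) (val c) ->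
  connect (fun a b => grid_adj a b && face_of (val b) (val c)) v w.
Proof.
case vE: (val v) => [[v1 v2] v3]; case wE: (val w) => [[w1 w2] w3].
case cE: (val c) => [[c1 c2] c3].
rewrite /cell_dim /= => v0 w0 vc wc.
have /and3P[ev1 ev2 ev3] : [&& ~~ odd v1, ~~ odd v2 & ~~ odd v3].
  by move: v0; case: odd; case: odd; case: odd.
have /and3P[ew1 ew2 ew3] : [&& ~~ odd w1, ~~ odd w2 & ~~ odd w3].
  by move: w0; case: odd; case: odd; case: odd.
have /and3P[/= vc1 vc2 vc3] := vc; have /and3P[/= wc1 wc2 wc3] := wc.
have ex_face t : face_of t (c1, c2, c3) -> exists x : K, val x = t.
  by rewrite -cE; apply: boundary_cell_ex.
have face_c t1 t2 t3 : face1 t1 c1 -> face1 t2 c2 -> face1 t3 c3 ->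
    face_of (t1, t2, t3) (c1, c2, c3) by move=> *; apply/and3P.
have [x xE] := ex_face _ (face_c _ _ _ wc1 vc2 vc3).
have [y yE] := ex_face _ (face_c _ _ _ wc1 wc2 vc3).
have go (a b e : K) : cell_dim (val a) = 0 -> cell_dim (val b) = 0 ->
    cell_dim (val e) = 1 -> face_of (val a) (val e) -> face_of (val b) (val e) ->
    face_of (val b) (c1, c2, c3) ->
    connect (fun a b => grid_adj a b && face_of (val b) (c1, c2, c3)) a b.
  move=> a0 b0 e1 ae be bc; apply: connect1; rewrite bc andbT /grid_adj a0 b0 /=.
  by apply/existsP; exists e; rewrite e1 ae be.
have dim0 a b c' : ~~ odd a -> ~~ odd b -> ~~ odd c' -> cell_dim (a, b, c') = 0.
  by rewrite /cell_dim /= => /negPf-> /negPf-> /negPf->.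
have dim1 a b c' : odd a + odd b + odd c' = 1 -> cell_dim (a, b, c') = 1 by [].
have f1c a : face1 a a by rewrite /face1 eqxx.
apply: (@connect_trans _ _ x).
  have [E|oc] := face1_even_eq vc1 wc1 ev1 ew1.
    by rewrite (_ : v = x) ?connect0 //; apply: val_inj; rewrite vE xE E.
  have [e eE] := ex_face _ (face_c _ _ _ (f1c c1) vc2 vc3).
  apply: (go _ _ e); rewrite ?vE ?xE ?eE.
  - exact: dim0.
  - exact: dim0.
  - by rewrite /cell_dim /= oc (negPf ev2) (negPf ev3).
  - by apply/and3P; split.
  - by apply/and3P; split.
  - exact: face_c.
apply: (@connect_trans _ _ y).
  have [E|oc] := face1_even_eq vc2 wc2 ev2 ew2.
    by rewrite (_ : x = y) ?connect0 //; apply: val_inj; rewrite yE xE E.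
  have [e eE] := ex_face _ (face_c _ _ _ wc1 (f1c c2) vc3).
  apply: (go _ _ e); rewrite ?yE ?xE ?eE.
  - exact: dim0.
  - exact: dim0.
  - by rewrite /cell_dim /= oc (negPf ew1) (negPf ev3).
  - by apply/and3P; split.
  - by apply/and3P; split.
  - exact: face_c.
have [E|oc] := face1_even_eq vc3 wc3 ev3 ew3.
  by rewrite (_ : y = w) ?connect0 //; apply: val_inj; rewrite yE wE E.
have [e eE] := ex_face _ (face_c _ _ _ wc1 wc2 (f1c c3)).
apply: (go _ _ e); rewrite ?yE ?wE ?eE.
- exact: dim0.
- exact: dim0.
- by rewrite /cell_dim /= oc (negPf ew1) (negPf ew2).
- by apply/and3P; split.
- by apply/and3P; split.
- exact: face_c.
Qed.

End Grid.

(** * A connected component of the surface as a cell complex *)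

Section Component.

Variables (N g : nat).
Hypothesis N0 : 0 < N.

Notation K := (cell N g).

Variable c0 : K.

Definition incident : rel K :=
  fun c d => face_of (val c) (val d) || face_of (val d) (val c).

(** Working in the component of [c0] gives a connected complex without a proof that the whole
    lattice surface is connected. *)
Definition in_component (d : nat) : pred K :=
  fun c => (cell_dim (val c) == d) && connect incident c0 c.

Definition component (d : nat) : finType := {c : K | in_component d c}.

Definition comp_val d (x : component d) : triple := val (val x).

Lemma comp_val_inj d : injective (@comp_val d).
Proof. exact: inj_comp val_inj val_inj. Qed.

Lemma comp_dim d (x : component d) : cell_dim (comp_val x) = d.
Proof. by have /andP[/eqP] := valP x. Qed.

Lemma comp_cell d (x : component d) : surface_cell N g (comp_val x).
Proof. exact: cellP. Qed.

Lemma comp_ex d (x : component d) (c : triple) d' :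
  surface_cell N g c -> cell_dim c = d' ->
  face_of c (comp_val x) || face_of (comp_val x) c ->
  exists y : component d', comp_val y = c.
Proof.
move=> cS dc fc; have [k kc] := cell_ex N0 cS.
have kP : in_component d' k.
  have /andP[_ xc] := valP x; rewrite /in_component kc dc eqxx.
  by apply: connect_trans xc (connect1 _); rewrite /incident kc orbC.
by exists (Sub k kP).
Qed.

Definition comp_inc d d' (x : component d) (y : component d') : bool :=
  face_of (comp_val x) (comp_val y).

Notation iv := (@comp_inc 0 1).
Notation ie := (@comp_inc 1 2).

Lemma card_vertices d (y : component d) :
  #|[set x : component 0 | comp_inc x y]| <= 2 ^ d.
Proof.
rewrite -[X in _ <= 2 ^ X](comp_dim y) -size_vertices; apply: card_le_size (@comp_val_inj 0) _ => x.
by rewrite inE; apply: face_dim0 (comp_dim x).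
Qed.

Lemma corner_face x f : corner iv ie x f -> comp_inc x f.
Proof. by case/existsP=> e /andP[]; apply: face_trans. Qed.

Lemma comp_vertex d (y : component d) : exists x : component 0, comp_inc x y.
Proof.
have [c cy c_dim] := has_vertex (comp_val y).
have [|x xE] := @comp_ex _ y c 0 (surface_face N0 cy (comp_cell y)) c_dim; first by rewrite cy.
by exists x; rewrite /comp_inc xE.
Qed.

(** The cells in the star of [x] are incident to [x], hence belong to its component. *)
Lemma comp_star (x : component 0) :
  exists (S : seq triple) (tr : triple -> triple),
    [/\ star_ok_in S /\ injective tr, (2, 2, 2) \in S /\ tr (2, 2, 2) = comp_val x,
        forall d (y : component d), comp_inc x y ->
          exists2 l, l \in S & comp_val y = tr l /\ cell_dim l = d,
        forall l d, l \in S -> cell_dim l = d ->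
          exists2 y : component d, comp_val y = tr l & comp_inc x y
      & {in S &, forall l l', face_of (tr l) (tr l') = face_of l l'}].
Proof.
have [S [tr [SP S2 xS Sx Sf]]] := surface_star N0 (comp_cell x) (comp_dim x).
exists S, tr; split=> //.
  move=> d y xy; have [l lS yl] := xS _ (comp_cell y) xy; exists l => //; split=> //.
  by have [_ <- _] := Sx l lS; rewrite -yl comp_dim.
move=> l d lS l_dim; have [lc ld lx] := Sx l lS.
have [||y yE] := @comp_ex _ x (tr l) d lc; rewrite ?ld ?lx ?orbT //.
by exists y => //; rewrite /comp_inc yE.
Qed.

Lemma star_edge (S : seq triple) (e : triple) : star_ok_in S -> (2, 2, 2) \in S ->
  e \in S -> cell_dim e = 1 ->
  0 < size [seq f <- S | (cell_dim f == 2) && face_of e f] <= 2.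
Proof.
move=> + S2 eS e1; rewrite /star_ok_in S2 => /and4P[_ _ /allP/(_ e) + _].
rewrite mem_filter e1 eS => /(_ isT); rewrite size_filter count_filter.
by rewrite (eq_count (a2 := fun f => (cell_dim f == 2) && face_of e f)) // => f /=; rewrite andbC.
Qed.

Lemma edge_faces (e : component 1) : #|[set f | ie e f]| <= 2.
Proof.
have [x xe] := comp_vertex e.
have [S [tr [[ok _] [S2 _] xS _ Sf]]] := comp_star x.
have [l lS [el l1]] := xS _ e xe.
have /andP[_] := star_edge ok S2 lS l1; apply: leq_trans.
rewrite -(size_map tr); apply: card_le_size (@comp_val_inj 2) _ => f.
rewrite inE => ef; have [l' l'S [fl' l'2]] := xS _ f (face_trans xe ef).
rewrite fl'; apply: map_f; rewrite mem_filter l'S l'2 /= andbT.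
by rewrite -Sf // -el -fl'.
Qed.

Lemma edge_face_ex (e : component 1) : exists f, ie e f.
Proof.
have [x xe] := comp_vertex e.
have [S [tr [[ok _] [S2 _] xS Sx Sf]]] := comp_star x.
have [l lS [el l1]] := xS _ e xe.
have /andP[+ _] := star_edge ok S2 lS l1; rewrite -has_predT => /hasP[l'].
rewrite mem_filter => /andP[/andP[/eqP l'2 ll'] l'S] _.
have [f fl' _] := Sx l' 2 l'S l'2; exists f.
by rewrite /comp_inc el fl' Sf.
Qed.

Lemma vertex_face_ex (x : component 0) : exists f, corner iv ie x f.
Proof.
have [S [tr [[ok _] [S2 trx] xS Sx Sf]]] := comp_star x.
move: (ok); rewrite /star_ok_in S2 => /and4P[_ + _ _].
case/hasP=> e; rewrite mem_filter => /andP[/eqP e1 eS] /hasP[f].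
rewrite mem_filter => /andP[/eqP f2 fS] ef.
have [y ye xy] := Sx e 1 eS e1; have [z zf _] := Sx f 2 fS f2.
exists z; apply/existsP; exists y; rewrite xy /comp_inc ye zf Sf //.
Qed.

Lemma vertex_link (x : component 0) (e0 : component 1) f f' :
  corner iv ie x f -> corner iv ie x f' -> connect (link iv ie x e0) f f'.
Proof.
move=> /corner_face xf /corner_face xf'.
have [S [tr [[ok trI] [S2 trx] xS Sx Sf]]] := comp_star x.
pose es := [seq l <- S | cell_dim l == 1].
pose fs := [seq l <- S | cell_dim l == 2].
(* [l0] is the local copy of the removed edge [e0], or the dummy [(2, 2, 2)] when [e0] does not
   occur in the star of [x]. *)
have [l0 l0es l0P] : exists2 l0, l0 \in (2, 2, 2) :: es &
    forall l, l \in es -> l != l0 -> tr l <> comp_val e0.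
  have [/hasP[l le /eqP lE]|/hasPn nl] := boolP (has (fun l => tr l == comp_val e0) es).
    exists l; first by rewrite inE le orbT.
    by move=> l' _ /eqP nl' E; apply: nl'; apply: trI; rewrite E.
  by exists (2, 2, 2); rewrite ?mem_head // => l /nl /eqP.
move: (ok); rewrite /star_ok_in S2 => /and4P[_ _ _ /allP/(_ l0 l0es)].
rewrite -/es -/fs /link_ok => linkok.
have [h [fs' fsE]] : exists h fs', fs = h :: fs'.
  have [l lS [_ l2]] := xS _ f xf; have : l \in fs by rewrite mem_filter l2.
  by case: (fs) => // h fs' _; exists h, fs'.
rewrite fsE in linkok; move/allP: linkok; rewrite -fsE => all_fs.
have : h \in fs by rewrite fsE mem_head.
rewrite mem_filter => /andP[/eqP h2 hS]; have [fh fhE xfh] := Sx h 2 hS h2.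
have reach n l : l \in iter n (grow es fs l0) [:: h] -> [/\ l \in S, cell_dim l = 2 &
    forall z : component 2, comp_val z = tr l -> connect (link iv ie x e0) fh z].
  elim: n l => [|n IH] l /=.
    rewrite inE => /eqP->; split=> // z zE.
    by rewrite (_ : z = fh) ?connect0 //; apply: (@comp_val_inj 2); rewrite zE fhE.
  rewrite !mem_filter => /andP[/orP[/IH //|/hasP[l' l'n /hasP[e ees /and3P[el0 el' el]]]]].
  case/andP=> /eqP l2 lS; split=> // z zE; have [l'S l'2 /(_ _) cl'] := IH l' l'n.
  have [z' z'E _] := Sx l' 2 l'S l'2.
  have enot := l0P e ees el0.
  move: ees; rewrite mem_filter => /andP[/eqP e1 eS]; have [e' e'E xe'] := Sx e 1 eS e1.
  apply: connect_trans (cl' z' z'E) (connect1 _); apply/existsP; exists e'.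
  rewrite xe' /comp_inc e'E zE z'E !Sf // el el' !andbT.
  by apply/eqP => e'e0; apply: enot; rewrite -e'E e'e0.
have linkC : connect_sym (link iv ie x e0).
  apply: sym_connect_sym => a b; apply: eq_existsb => e; do 2!congr andb; exact: andbC.
have to_h z : comp_inc x z -> connect (link iv ie x e0) fh z.
  move=> xz; have [l lS [zl l2]] := xS _ z xz.
  have /all_fs/reach[_ _] : l \in fs by rewrite mem_filter l2.
  by apply.
by apply: connect_trans (to_h f' xf'); rewrite linkC; apply: to_h.
Qed.

Lemma face_vertex_ex (f : component 2) : exists x, corner iv ie x f.
Proof.
have [|c cf] := @boundary_cell (comp_val f); first by rewrite comp_dim.
rewrite comp_dim => -[dc].
have [|e eE] := @comp_ex _ f c 1 (surface_face N0 cf (comp_cell f)) dc; first by rewrite cf.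
have [x xe] := comp_vertex e; exists x; apply/existsP; exists e.
by rewrite xe /comp_inc eE.
Qed.

(** For [k] equal to [g], 1 and 0 there are at most [2 * (k.*2 + 3)] special values of the first,
    second and third coordinate. The product is linear in [g]. *)
Definition euler_defect := 2 * (g.*2 + 3) * 10 * 6.

(** [toggle] sends the edges with a non-special coordinate injectively to vertices and faces of the
    same component; the other edges are counted by [euler_defect]. *)
Lemma euler_bound :
  #|component 1| <= #|component 0| + #|component 2| + euler_defect.
Proof.
pose sp k := [seq q * N.*2 | q <- iota 0 (k.*2 + 3)] ++
             [seq q * N.*2 + N.*2.-1 | q <- iota 0 (k.*2 + 3)].
pose A := [set e : component 1 | all_special N (comp_val e)].
have cA : #|A| <= euler_defect.
  have sz k : size (sp k) = 2 * (k.*2 + 3) by rewrite size_cat !size_map size_iota; lia.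
  have -> : euler_defect = size (triples (sp g) (sp 1) (sp 0)).
    by rewrite size_triples !sz.
  apply: card_le_size (@comp_val_inj 1) _ => e; rewrite inE mem_triples.
  have [/andP[_ b1] /andP[_ b2] /andP[_ b3]] := surface_bound N0 (comp_cell e).
  case/and3P=> s1 s2 s3; apply/and3P.
  by split; [exact: special_bound b1 s1 | exact: (@special_bound N 1) | exact: (@special_bound N 0)].
have /fin_all_exists[t tP] : forall e : component 1,
    exists y : component 0 + component 2, e \notin A ->
      toggle N (comp_val e) = match y with inl x => comp_val x | inr f => comp_val f end.
  move=> e; have [eA|] := boolP (e \in A).
    by have [x _] := comp_vertex e; exists (inl x).
  rewrite inE => ne; have [_ _ tS todd tf] := toggle_spec N0 g ne.
  rewrite comp_cell in tS; rewrite comp_dim in todd.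
  have dim_tog : cell_dim (toggle N (comp_val e)) = 0 \/ cell_dim (toggle N (comp_val e)) = 2.
    move: todd; rewrite /cell_dim !oddD !oddb.
    by do 3!case: (odd _); (try by []); move=> _; first [by left | by right].
  have [d0|d2] := dim_tog.
    by have [|y yE] := @comp_ex _ e _ 0 tS d0; [rewrite orbC | exists (inl y)]; rewrite ?yE // orbC.
  by have [|y yE] := @comp_ex _ e _ 2 tS d2; [rewrite orbC | exists (inr y)]; rewrite ?yE // orbC.
have cnA : #|~: A| <= #|component 0| + #|component 2|.
  rewrite -card_sum -(@card_in_imset _ _ t) ?max_card //.
  move=> e e'; rewrite inE => eA; rewrite inE => e'A tee.
  have := tP e eA; rewrite tee -(tP e' e'A) => tog.
  move: eA e'A; rewrite !inE => eA e'A.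
  apply: (@comp_val_inj 1); have [_ <- _ _ _] := toggle_spec N0 g eA.
  by rewrite tog; have [] := toggle_spec N0 g e'A.
by rewrite -(cardsC A) addnC leq_add.
Qed.

End Component.

(** * From branch sets in the lattice graph to a decomposition of the graph *)

Section GridMinor.

Variables (N g : nat).
Hypothesis N0 : 0 < N.

Notation K := (cell N g).

Variable c0 : K.
Hypothesis c0_dim : cell_dim (val c0) = 0.

Notation V := (component c0 0).
Notation iv := (@comp_inc N g c0 0 1).
Notation ie := (@comp_inc N g c0 1 2).

Lemma comp_adj (x : V) (b : K) : grid_adj (val x) b ->
  exists2 y : V, val y = b & skel iv x y.
Proof.
case/and3P=> _ /eqP b0 /existsP[e /and3P[/eqP e1 xe be]].
have [|e' e'E] := @comp_ex N g N0 c0 _ x (val e) 1 (cellP e) e1; first by apply/orP; right.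
have [|y yE] := @comp_ex N g N0 c0 _ e' (val b) 0 (cellP b) b0; first by rewrite e'E; apply/orP; left.
exists y; first exact: val_inj.
by apply/existsP; exists e'; rewrite /comp_inc yE e'E be /comp_val xe.
Qed.

(** Consecutive cells of a chain of incident cells from [c0] share a vertex [w], and the vertices of
    one cell are joined by [corners_connect]. *)
Lemma skel_connected (x y : V) : connect (skel iv) x y.
Proof.
have toK (z : V) : connect (@grid_adj N g) c0 (val z).
  have corners (c : K) : connect (@incident N g) c0 c ->
      forall v : K, cell_dim (val v) = 0 -> face_of (val v) (val c) ->
      connect (@grid_adj N g) c0 v.
    case/connectP=> p; elim/last_ind: p c => [|p d IH] c /=.
      move=> _ -> v v0 vc; have := corners_connect N0 c0_dim v0 (face_refl _) vc.
      by apply: connect_sub => a b /andP[ab _]; apply: connect1.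
    rewrite rcons_path last_rcons => /andP[pp ld] -> v v0 vd.
    have IHl := IH _ pp erefl.
    have [w [w0 wl wd]] : exists w : K, [/\ cell_dim (val w) = 0,
        face_of (val w) (val (last c0 p)) & face_of (val w) (val d)].
      case/orP: ld => f.
        have [t tl t0] := has_vertex (val (last c0 p)).
        have [w wE] := boundary_cell_ex N0 tl.
        by exists w; rewrite wE; split=> //; apply: face_trans tl f.
      have [t tl t0] := has_vertex (val d); have [w wE] := boundary_cell_ex N0 tl.
      by exists w; rewrite wE; split=> //; apply: face_trans tl f.
    apply: connect_trans (IHl w w0 wl) _.
    have := corners_connect N0 w0 v0 wd vd.
    by apply: connect_sub => a b /andP[ab _]; apply: connect1.
  have /andP[/eqP z0 zc] := valP z; exact: corners zc _ z0 (face_refl _).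
apply: (@connect_lift _ _ (@grid_adj N g)).
  by move=> a b /comp_adj[b' <- ab']; exists b' => //; apply: connect1.
have sym := sym_connect_sym (@grid_adj_sym N g).
by apply: connect_trans (toK y); rewrite sym.
Qed.

End GridMinor.

Theorem grid_minor_decomposition (N g : nat) (T : finType) (G : rel T)
    (B : T -> {set cell N g}) :
  0 < N ->
  (forall u v, connect G u v) ->
  irreflexive G ->
  (forall u x, x \in B u -> cell_dim (val x) = 0) ->
  (forall u, exists x, x \in B u) ->
  (forall u v x, x \in B u -> x \in B v -> u = v) ->
  (forall u, {in B u &, forall x y,
     connect (fun a b => grid_adj a b && (b \in B u)) x y}) ->
  (forall u v, G u v -> exists x y, [/\ x \in B u, y \in B v & grid_adj x y]) ->
  exists (ell : T -> nat) (C : rel T) (col : T -> 'I_((euler_defect g).*2 + 8).+1),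
    [/\ symmetric C /\ irreflexive C,
        forall (n : nat) (f : 'I_n -> T), 4 <= n ->
          ~ (injective f /\
             forall i j : 'I_n, C (f i) (f j) = (j == ordS i) || (i == ordS j)),
        forall u v, G u v -> C u v,
        forall u v, G u v -> ell v <= (ell u).+1
      & forall u v, C u v -> ell u = ell v -> col u != col v].
Proof.
move=> N0 cG irrG Bdim Bex Bdisj Bconn Badj.
have [u0 _|T0] := pickP (fun _ : T => true); last first.
  exists (fun=> 0), (fun _ _ => false), (fun=> ord0); split=> // [n f n4|u]; last by have := T0 u.
  have n0 : 0 < n by apply: leq_trans n4.
  by have := T0 (f (Ordinal n0)).
have [c0 Bc0] := Bex u0; have c0_dim := Bdim _ _ Bc0.
pose V := component c0 0.
have inc_adj (a b : cell N g) : grid_adj a b -> connect (@incident N g) a b.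
  case/and3P=> _ _ /existsP[e /and3P[_ ae be]].
  apply: (@connect_trans _ _ e); apply: connect1; rewrite /incident ?ae //.
  by rewrite be orbT.
(* [G] is connected and the branch sets of adjacent vertices are joined by a lattice edge, so all
   branch sets lie in the component of [c0]. *)
have Bcomp u x : x \in B u -> in_component c0 0 x.
  rewrite /in_component => xu; rewrite (Bdim _ _ xu) eqxx /=.
  have conn_in v a b : a \in B v -> b \in B v -> connect (@incident N g) a b.
    move=> av bv; have := Bconn v a b av bv.
    by apply: connect_sub => p q /andP[pq _]; apply: inc_adj.
  have : connect G u0 u by [].
  case/connectP=> p; elim/last_ind: p u x xu => [|p w IH] u x xu /=.
    by move=> _ uu0; apply: (conn_in u); rewrite // uu0.
  rewrite rcons_path last_rcons => /andP[pp lw] uw.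
  have [a [b [al bw ab]]] := Badj _ _ lw.
  apply: connect_trans (IH _ a al pp erefl) _.
  apply: connect_trans (inc_adj _ _ ab) _; apply: (conn_in w) => //.
  by rewrite -uw.
(* The vertices outside the branch sets are contracted to themselves, so [G] is
   only a subgraph of the quotient. *)
pose phi0 (x : V) : T + V := if [pick u | val x \in B u] is Some u then inl u else inr x.
have phi0_B u (x : V) : val x \in B u -> phi0 x = inl u.
  rewrite /phi0; case: pickP => [v xv xu|/(_ u) ->//].
  by rewrite (Bdisj _ _ _ xv xu).
have phi0_inl u (x : V) : phi0 x = inl u -> val x \in B u.
  by rewrite /phi0; case: pickP => // v xv [<-].
have phi0_inr (x y : V) : phi0 x = inr y -> x = y.
  by rewrite /phi0; case: pickP => // _ [].
(* Restricting to the image of [phi0] makes [phi] surjective. *)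
pose W : finType := {w | w \in codom phi0}.
pose phi (x : V) : W := Sub (phi0 x) (codom_f phi0 x).
have phiE x y : (phi x == phi y) = (phi0 x == phi0 y) by [].
have surj w : exists x, phi x = w.
  by have /codomP[x xw] := valP w; exists x; apply: val_inj; rewrite -[RHS]/(val w) xw.
(* [phi (s u)] is the class onto which [B u] is contracted; along it the data on [W] are pulled back
   to [T]. *)
have /fin_all_exists[s sP] : forall u, exists x : V, val x \in B u.
  by move=> u; have [x xu] := Bex u; exists (Sub x (Bcomp _ _ xu)); rewrite SubK.
have phi_s u (x : V) : val x \in B u -> phi x = phi (s u).
  by move=> xu; apply: val_inj; rewrite /= (phi0_B _ _ xu) (phi0_B _ _ (sP u)).
have s_inj : injective (phi \o s).
  by move=> u v /(congr1 val) /=; rewrite !(phi0_B _ _ (sP _)) => -[].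
have cphi (x y : V) : phi x = phi y ->
    connect (fun a b => skel (@comp_inc N g c0 0 1) a b && (phi a == phi b)) x y.
  move=> /(congr1 val) /=; case xE: (phi0 x) => [u|x']; last first.
    by move/esym/phi0_inr=> ->; rewrite (phi0_inr _ _ xE) connect0.
  move/esym=> yE; have xu := phi0_inl _ _ xE; have yu := phi0_inl _ _ yE.
  pose R a b := [&& a \in B u, grid_adj a b & b \in B u].
  apply: (@connect_lift _ _ R).
    move=> a b /and3P[au /(comp_adj N0)[b' <- ab'] b'u]; exists b' => //.
    by apply: connect1; rewrite ab' phiE (phi0_B _ _ au) (phi0_B _ _ b'u) eqxx.
  have /connectP[p pp ->] := Bconn u _ _ xu yu.
  elim: p (val x) xu pp {yE yu y} => [|b p IH] a au /=; first by rewrite connect0.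
  case/andP=> /andP[ab bu] pp; apply: connect_trans (IH b bu pp).
  by apply: connect1; rewrite /R au ab bu.
have corner4 f : #|[set x | corner (@comp_inc N g c0 0 1) (@comp_inc N g c0 1 2) x f]| <= 4.
  apply: leq_trans (card_vertices f); apply: subset_leq_card.
  by apply/subsetP=> x; rewrite !inE; apply: corner_face.
have [ell [C [col [ [Csym Cirr] Cch CG ellG colP] ] ] ] := layered_decomposition
  (@card_vertices N g c0 1) (edge_faces N0 (c0 := c0)) (edge_face_ex N0 (c0 := c0))
  (vertex_face_ex N0 (c0 := c0)) (face_vertex_ex N0 (c0 := c0)) corner4
  (vertex_link N0 (c0 := c0)) (skel_connected N0 c0_dim (s u0)) surj cphi (euler_bound N0 c0).
have adjG u v : G u v -> exists x y : V,
    [/\ skel (@comp_inc N g c0 0 1) x y, phi x = phi (s u) & phi y = phi (s v)].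
  move=> /Badj[x [y [xu yv xy] ] ]; pose x' : V := Sub x (Bcomp _ _ xu).
  have [|y' y'E x'y'] := @comp_adj N g N0 c0 x' y; first by rewrite SubK.
  by exists x', y'; split=> //; apply: phi_s; rewrite ?y'E ?SubK.
exists (fun u => ell (phi (s u))), (fun u v => C (phi (s u)) (phi (s v))), (fun u => col (phi (s u))).
split.
- by split=> [u v|u]; [apply: Csym | apply: Cirr].
- move=> n f n4 [finj fC]; apply: (Cch n (fun i => phi (s (f i))) n4); split=> // i j.
  by move/s_inj/finj.
- move=> u v uv; have [x [y [xy xu yv] ] ] := adjG u v uv; rewrite -xu -yv.
  apply: CG => //; rewrite xu yv; apply: contraTneq uv => /s_inj->.
  by rewrite irrG.
- by move=> u v /adjG[x [y [xy <- <-] ] ]; apply: ellG.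
- by move=> u v; apply: colP.
Qed.

(** * Branch sets obtained from disjoint connected sets and the links between them *)

Definition connected_in (V : finType) (adj : rel V) (S : {set V}) : Prop :=
  {in S &, forall x y, connect (fun a b => adj a b && (b \in S)) x y}.

(* Each link [M u v] is cut where it first meets [A v], and what precedes is
   given to [u]. *)
Lemma grow_branch_sets (V T : finType) (adj : rel V) (E : rel T)
    (A : T -> {set V}) (M : T -> T -> {set V}) :
  symmetric adj ->
  (forall u v, E u v -> ~~ E v u) ->
  (forall u, exists x, x \in A u) ->
  (forall u, connected_in adj (A u)) ->
  (forall u v x, x \in A u -> x \in A v -> u = v) ->
  (forall u v, E u v -> connected_in adj (M u v)) ->
  (forall u v, E u v -> exists x, (x \in M u v) && (x \in A u)) ->
  (forall u v, E u v -> exists x, (x \in M u v) && (x \in A v)) ->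
  (forall u v w x, E u v -> x \in M u v -> x \in A w -> w = u \/ w = v) ->
  (forall u v u' v' x, E u v -> E u' v' -> x \in M u v -> x \in M u' v' ->
     u = u' /\ v = v') ->
  exists B : T -> {set V},
    [/\ forall u, exists x, x \in B u,
        forall u v x, x \in B u -> x \in B v -> u = v,
        forall u, connected_in adj (B u),
        forall u v, E u v -> exists x y, [/\ x \in B u, y \in B v & adj x y]
      & forall u x, x \in B u ->
          x \in A u \/ exists2 v, E u v & x \in M u v].
Proof.
move=> adjC EN Aex Aconn Adisj Mconn MAu MAv MA MM.
pose Z u := A u :|: \bigcup_(v | E u v) (M u v :\: A v).
have ZP u x : x \in Z u -> x \in A u \/ exists2 v, E u v & (x \in M u v) && (x \notin A v).
  rewrite inE => /orP[xA|/bigcupP[v uv]]; first by left.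
  by rewrite inE andbC => xM; right; exists v.
have Zdisj u v x : x \in Z u -> x \in Z v -> u = v.
  move=> /ZP xu /ZP; case: xu => [xu|[w uw /andP[xM xw]]] [xv|[w' vw' /andP[xM' xw']]].
  - exact: Adisj xu xv.
  - by case: (MA _ _ _ _ vw' xM' xu) => // uw'; rewrite -uw' xu in xw'.
  - by case: (MA _ _ _ _ uw xM xv) => // vw; rewrite -vw xv in xw.
  - by have [] := MM _ _ _ _ _ uw vw' xM xM'.
have /fin_all_exists[r rA] := Aex.
pose Zadj u : rel V := fun a b => [&& a \in Z u, adj a b & b \in Z u].
have ZC u : connect_sym (Zadj u).
  apply: sym_connect_sym => a b; rewrite /Zadj adjC.
  by case: (a \in _); case: (b \in _); rewrite ?andbF.
(* [Z u] may be disconnected, since a link can enter and leave [A v] repeatedly; only the part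
   attached to [A u] is kept. *)
pose B u := [set x in Z u | connect (Zadj u) (r u) x].
have AZ u : A u \subset Z u by apply: subsetUl.
have AB u x : x \in A u -> x \in B u.
  move=> xA; rewrite inE (subsetP (AZ u)) //=.
  have /connectP[p pp ->] := Aconn u _ _ (rA u) xA; move: (r u) (rA u) pp.
  elim: p => [|b p IH] a aA /=; first by rewrite connect0.
  case/andP=> /andP[ab bA] pp; apply: connect_trans (IH b bA pp); apply: connect1.
  by rewrite /Zadj ab !(subsetP (AZ u)).
have BZ u x : x \in B u -> x \in Z u by rewrite inE => /andP[].
have Bdisj u v x : x \in B u -> x \in B v -> u = v.
  by move=> /BZ xu /BZ; apply: Zdisj xu.
exists B; split=> //.
- by move=> u; exists (r u); apply: AB.
- move=> u x y; rewrite inE => /andP[xZ rx]; rewrite inE => /andP[yZ ry].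
  have /connectP[p pp ->] : connect (Zadj u) x y by apply: connect_trans ry; rewrite ZC.
  elim: p x xZ rx pp => [|b p IH] a aZ ra /=; first by rewrite connect0.
  case/andP=> ab pp; have rb := connect_trans ra (connect1 ab).
  have /and3P[_ adjab bZ] := ab.
  apply: connect_trans (IH b bZ rb pp); apply: connect1; rewrite adjab.
  by rewrite inE bZ.
(* Following the link from [A u], one stays in [B u] up to the first point whose successor is in
   [A v]. There is one because the link reaches [A v], which is disjoint from [B u]. *)
- move=> u v uv; have [x /andP[xM xA]] := MAu _ _ uv; have [y /andP[yM yA]] := MAv _ _ uv.
  have /connectP[p pp lp] := Mconn _ _ uv _ _ xM yM.
  have {xA} := AB _ _ xA; rewrite {}lp in yA; elim: p x xM pp yA {yM} => [|b p IH] a aM /=.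
    move=> _ aA aB; have uv' := Bdisj _ _ _ aB (AB _ _ aA).
    by have := EN _ _ uv; rewrite -uv' in uv *; rewrite uv.
  case/andP=> /andP[ab bM] pp lA aB; have [bA|bA] := boolP (b \in A v).
    by exists a, b; split=> //; apply: AB.
  apply: IH pp lA _ => //; have bZ : b \in Z u.
    by rewrite inE; apply/orP; right; apply/bigcupP; exists v; rewrite // inE bA.
  move: aB; rewrite [a \in B u]inE [b \in B u]inE bZ => /andP[aZ ra]; apply: connect_trans ra (connect1 _).
  by rewrite /Zadj aZ ab.
- by move=> u x /BZ/ZP[?|[v uv /andP[xM _]]]; [left|right; exists v].
Qed.

(** * Inequalities satisfied by the points of the surface *)

Import classical_sets.
Local Open Scope classical_set_scope.
Local Open Scope ring_scope.

Section Surface.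

Variable R : realType.

Lemma fst1_continuous : continuous (fun p : R * R * R => p.1.1).
Proof. by move=> p; apply: (cvg_comp (fun q : R * R * R => q.1) fst); exact: cvg_fst. Qed.

Lemma snd1_continuous : continuous (fun p : R * R * R => p.1.2).
Proof.
move=> p; apply: (cvg_comp (fun q : R * R * R => q.1) snd).
  exact: cvg_fst.
exact: cvg_snd.
Qed.

Lemma snd_continuous : continuous (fun p : R * R * R => p.2).
Proof. by move=> p; exact: cvg_snd. Qed.

Lemma near_gt (f : R * R * R -> R) p a : continuous f -> a < f p ->
  \forall q \near p, a < f q.
Proof. by move=> cf ap; exact: (cf p _ (lt_nbhsr ap)). Qed.

Lemma near_lt (f : R * R * R -> R) p a : continuous f -> f p < a ->
  \forall q \near p, f q < a.
Proof. by move=> cf ap; exact: (cf p _ (lt_nbhsl ap)). Qed.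

Lemma closure_near (H : set (R * R * R)) p (P : R * R * R -> Prop) :
  closure H p -> (forall q, H q -> ~ P q) -> ~ (\forall q \near p, P q).
Proof. by move=> Hp HP /Hp[q [/HP]]. Qed.

Lemma handlebody_closed g p : closure (@handlebody R g) p -> handlebody g p.
Proof.
move=> cp; have [c1 [c2 c3]] := (fst1_continuous, (snd1_continuous, snd_continuous)).
have low (f : R * R * R -> R) a : continuous f ->
    (forall q, handlebody g q -> a <= f q) -> a <= f p.
  move=> cf ha; rewrite leNgt; apply/negP => /(near_lt cf).
  by apply: closure_near cp _ => q /ha; rewrite leNgt => /negP.
have up (f : R * R * R -> R) a : continuous f ->
    (forall q, handlebody g q -> f q <= a) -> f p <= a.
  move=> cf ha; rewrite leNgt; apply/negP => /(near_gt cf).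
  by apply: closure_near cp _ => q /ha; rewrite leNgt => /negP.
split.
- by apply/andP; split; [apply: (low _ _ c1)|apply: (up _ _ c1)] => q [/andP[]].
- by apply/andP; split; [apply: (low _ _ c2)|apply: (up _ _ c2)] => q [_ /andP[]].
- by apply/andP; split; [apply: (low _ _ c3)|apply: (up _ _ c3)] => q [_ _ /andP[]].
move=> i ig [/andP[x1 x2] /andP[y1 y2]].
have : \forall q \near p, (i.*2.+1)%:R < q.1.1 < (i.*2.+2)%:R /\ 1 < q.1.2 < 2.
  near=> q; split; apply/andP; split; near: q;
    [exact: (near_gt c1)|exact: (near_lt c1)|exact: (near_gt c2)|exact: (near_lt c2)].
by apply: closure_near cp _ => q [_ _ _ /(_ i ig)].
Unshelve. all: by end_near. Qed.

(** A point strictly inside the box and off all closed tunnels would be interior: finitely many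
    strict inequalities persist nearby. Indexing the tunnels by ['I_g] lets [filter_forall]
    intersect the neighbourhoods. *)
Lemma surface_coords g p : @surface R g p ->
  handlebody g p /\
  ((0 < p.1.1 < (g.*2.+1)%:R /\ 0 < p.1.2 < 3 /\ 0 < p.2 < 1) ->
   ~ ((forall i, (i < g)%N -> ~ ((i.*2.+1)%:R <= p.1.1 <= (i.*2.+2)%:R)) \/
      ~ (1 <= p.1.2 <= 2))).
Proof.
case=> /handlebody_closed hp ni; split=> // -[/andP[x1 x2] [/andP[y1 y2] /andP[z1 z2]]] out.
apply: ni; have [c1 [c2 c3]] := (fst1_continuous, (snd1_continuous, snd_continuous)).
have tun (i : 'I_g) : \forall q \near p,
    ~ ((i.*2.+1)%:R < q.1.1 < (i.*2.+2)%:R /\ 1 < q.1.2 < 2).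
  case: out => [/(_ i (ltn_ord i))/negP|/negP].
    rewrite negb_and -!ltNge => /orP[lt|lt].
      by near=> q; case=> /andP[+ _] _; apply/negP; rewrite -leNgt ltW //; near: q; exact: (near_lt c1).
    by near=> q; case=> /andP[_ +] _; apply/negP; rewrite -leNgt ltW //; near: q; exact: (near_gt c1).
  rewrite negb_and -!ltNge => /orP[lt|lt].
    by near=> q; case=> _ /andP[+ _]; apply/negP; rewrite -leNgt ltW //; near: q; exact: (near_lt c2).
  by near=> q; case=> _ /andP[_ +]; apply/negP; rewrite -leNgt ltW //; near: q; exact: (near_gt c2).
have {}tun := filter_forall (nbhs_filter p) tun.
rewrite /interior /=; near=> q; split.
- by apply/andP; split; apply: ltW; near: q; [exact: (near_gt c1)|exact: (near_lt c1)].
- by apply/andP; split; apply: ltW; near: q; [exact: (near_gt c2)|exact: (near_lt c2)].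
- by apply/andP; split; apply: ltW; near: q; [exact: (near_gt c3)|exact: (near_lt c3)].
move=> i ig; have : forall i : 'I_g,
    ~ ((i.*2.+1)%:R < q.1.1 < (i.*2.+2)%:R /\ 1 < q.1.2 < 2) by near: q.
by move=> /(_ (Ordinal ig)).
Unshelve. all: by end_near. Qed.

End Surface.

(** * The lattice cell containing a point *)

Section PointCell.

Variable R : realType.

Definition cell_index (y : R) : nat :=
  let k := Num.truncn y in if y == k%:R then k.*2 else k.*2.+1.

Lemma cell_indexP y : 0 <= y ->
  (exists2 k : nat, y = k%:R & cell_index y = k.*2) \/
  (exists2 k : nat, k%:R < y < k.+1%:R & cell_index y = k.*2.+1).
Proof.
move=> /truncn_itv/andP[y1 y2]; rewrite /cell_index /=.
case: eqP => [yk|/eqP yk]; [left|right]; exists (Num.truncn y) => //.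
by rewrite y2 lt_neqAle eq_sym yk y1.
Qed.

(** This ties combinatorics to topology: the cells having a given vertex as a face fill an open
    interval of radius 1, in each coordinate. *)
Lemma near_vertex y v : 0 <= y -> ~~ odd v ->
  (`|y - (v./2)%:R| < 1) = face1 v (cell_index y).
Proof.
move=> y0 ev; set h := v./2; have vE : v = h.*2 by rewrite /h; lia.
have -> : (`|y - h%:R| < 1) = (y < h.+1%:R) && (h%:R < y + 1).
  by rewrite ltr_norml -natr1; apply/idP/idP => /andP[a b]; apply/andP; split; lra.
have [[k -> ->]|[k /andP[k1 k2] ->]] := cell_indexP y0.
  by rewrite natr1 !ltr_nat vE /face1; lia.
have -> : (y < h.+1%:R) = (k <= h)%N.
  apply/idP/idP => [yh|kh]; first by rewrite -ltnS -(ltr_nat R) (lt_trans k1).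
  by rewrite (lt_le_trans k2) // ler_nat.
have -> : (h%:R < y + 1) = (h <= k.+1)%N.
  apply/idP/idP => [yh|kh]; last first.
    by rewrite (@le_lt_trans _ _ k.+1%:R) ?ler_nat // -natr1 ltrD2r.
  by rewrite -ltnS -(ltr_nat R) (lt_trans yh) // -natr1 ltrD2r.
by rewrite vE /face1; lia.
Qed.

Lemma cell_index_split N y : (0 < N)%N -> 0 <= y ->
  exists q : nat,
    (y = q%:R /\ cell_index (N%:R * y) = (q * N.*2)%N) \/
    (q%:R < y < q.+1%:R /\ exists k : nat,
       (0 < k < N.*2)%N /\ cell_index (N%:R * y) = (q * N.*2 + k)%N).
Proof.
move=> N0 y0; have n0 : 0 < N%:R :> R by rewrite ltr0n.
have Y0 : 0 <= N%:R * y by rewrite mulr_ge0.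
have lt_q (k q : nat) z : k%:R <= z -> z = N%:R * y -> (q * N < k)%N -> q%:R < y.
  move=> kz zE qk; rewrite -(ltr_pM2l n0) -zE (lt_le_trans _ kz) //.
  by rewrite -natrM ltr_nat mulnC.
have lt_q' (k q : nat) z : z < k%:R -> z = N%:R * y -> (k <= q * N)%N -> y < q%:R.
  move=> kz zE qk; rewrite -(ltr_pM2l n0) -zE (lt_le_trans kz) //.
  by rewrite -natrM ler_nat mulnC.
have [[k Yk ->]|[k /andP[k1 k2] ->]] := cell_indexP Y0.
  have [r0|r0] := posnP (k %% N); exists (k %/ N)%N; [left|right].
    split; last by rewrite {1}(divn_eq k N) r0; lia.
    by apply: (mulfI (lt0r_neq0 n0)); rewrite Yk -natrM {1}(divn_eq k N) r0 addn0 mulnC.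
  split; last first.
    exists ((k %% N).*2); split; first by rewrite double_gt0 r0 ltn_double ltn_pmod.
    by rewrite {1}(divn_eq k N); lia.
  have kE := divn_eq k N; have rN := ltn_pmod k N0.
  rewrite (lt_q k _ _ _ (esym Yk)) ?lexx //=; last by rewrite {2}kE; lia.
  have -> // : y < (k %/ N).+1%:R.
  rewrite -(ltr_pM2l n0) Yk -natrM ltr_nat mulnS {1}kE mulnC addnC ltn_add2r //.
exists (k %/ N)%N; right; have kE := divn_eq k N; have rN := ltn_pmod k N0.
split; last first.
  exists ((k %% N).*2.+1); split; last by rewrite {1}kE; lia.
  by apply/andP; split=> //; lia.
apply/andP; split; last first.
  by apply: (lt_q' k.+1 _ _ k2 erefl); rewrite mulSn {1}kE; lia.
rewrite -(ltr_pM2l n0) (le_lt_trans _ k1) // -natrM ler_nat mulnC {2}kE; lia.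
Qed.

(** The shift [x + 1] is the one built into [position_of]: its plane [q] is the real plane
    [q - 1]. *)
Lemma position_coord N g x : (0 < N)%N -> 0 <= x <= (g.*2.+1)%:R ->
  let t := position_of N g (cell_index (N%:R * (x + 1))) in
  [/\ ~~ is_out t,
      is_tunnel t -> exists2 i, (i < g)%N & (i.*2.+1)%:R < x < (i.*2.+2)%:R,
      ~~ is_border t -> 0 < x < (g.*2.+1)%:R
    & ~~ in_tunnel t -> forall i, (i < g)%N -> ~ (i.*2.+1)%:R <= x <= (i.*2.+2)%:R].
Proof.
move=> N0 /andP[x0 xg] t; have y0 : 0 <= x + 1 by lra.
rewrite -natr1 in xg; have xg1 : x + 1 <= (g.*2.+2)%:R by rewrite -[g.*2.+2]addn2 natrD; lra.
have [q [[yq tE]|[/andP[q1 q2] [k [k0 tE]]]]] := cell_index_split N0 y0; rewrite /t tE.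
  have q1 : (1 <= q)%N by rewrite -(ler_nat R) -yq; lra.
  have qg : (q <= g.*2.+2)%N by rewrite -(ler_nat R) -yq.
  have xE : x = q.-1%:R by case: (q) q1 yq => // q' _; rewrite -natr1 => /addIr.
  rewrite position_plane // (_ : _ || _ = false); last by lia.
  rewrite xE; split.
  - by case: ifP.
  - by case: ifP.
  - by case: ifP => // qn _; rewrite ltr0n ltr_nat; lia.
  - by case: ifP => // qn _ i ig; rewrite !ler_nat; lia.
have q_gt0 : (0 < q)%N by rewrite -ltnS -(ltr_nat R) (le_lt_trans _ q2) //; lra.
have qg : (q < g.*2.+2)%N by rewrite -(ltr_nat R) (lt_le_trans q1).
have xq : q.-1%:R < x < q%:R.
  by case: (q) q_gt0 q1 q2 => // q' _; rewrite -!natr1 /= => a b; apply/andP; split; lra.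
have /andP[xq1 xq2] := xq.
rewrite position_interval // (_ : _ || _ = false); last by lia.
split; first by case: ifP.
- case: ifP => // oq _; exists (q./2.-1); first by lia.
  have e2 : (q./2.-1).*2.+2 = q by lia.
  by rewrite e2; have -> : (q./2.-1).*2.+1 = q.-1 by lia.
- move=> _; rewrite (le_lt_trans _ xq1) ?ler0n //= (lt_le_trans xq2) // ler_nat; lia.
- case: ifP => // oq _ i ig /andP[i1 i2].
  have : (i.*2.+1 < q)%N by rewrite -(ltr_nat R) (le_lt_trans i1).
  have : (q.-1 < i.*2.+2)%N by rewrite -(ltr_nat R) (lt_le_trans xq1).
  by clear - oq q_gt0; lia.
Qed.

Definition point_cell N (p : R * R * R) : triple :=
  (cell_index (N%:R * (p.1.1 + 1)), cell_index (N%:R * (p.1.2 + 1)),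
   cell_index (N%:R * (p.2 + 1))).

(** Lying in the box excludes [Out], avoiding the open tunnels gives the second clause of
    [on_surface], and not being interior gives the third. *)
Lemma surface_point_cell N g p : (0 < N)%N -> @surface R g p ->
  surface_cell N g (point_cell N p).
Proof.
move=> N0 /surface_coords[[hx hy hz ht] hb].
have [x1 x2 x3 x4] := position_coord N0 hx.
have [|y1 y2 y3 y4] := @position_coord N 1 p.1.2 N0; first by [].
have [|z1 z2 z3 z4] := @position_coord N 0 p.2 N0; first by [].
rewrite /surface_cell /on_surface /=; apply/and3P; split.
- by rewrite !negb_or x1 y1 z1.
- apply/negP => /andP[tx ty]; have [i ig xi] := x2 tx; have [j] := y2 ty.
  by rewrite ltnS leqn0 => /eqP-> yj; apply: (ht i ig).
- apply: contraT; rewrite !negb_or negb_and.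
  case/and4P=> /x3 bx /y3 bY /z3 bz; case/orP=> [/x4 nx|/y4 ny].
    by case: (hb (conj bx (conj bY bz)) (or_introl nx)).
  by case: (hb (conj bx (conj bY bz))); right; exact: (ny 0).
Qed.

End PointCell.

(** * Traces of sets on the lattice, and their separation at a fine mesh *)

Section Trace.

Variable R : realType.
Notation X := (R * R * R)%type.

Definition near1 (N v : nat) (x : R) : bool := `|N%:R * (x + 1) - (v./2)%:R| < 1.

(** The open cube of half-side [1 / N] around a lattice point, which meets the surface in the open
    star of that vertex. *)
Definition in_star (N : nat) (v : triple) (p : X) : bool :=
  [&& near1 N v.1.1 p.1.1, near1 N v.1.2 p.1.2 & near1 N v.2 p.2].

Lemma near1_open (N v : nat) (f : X -> R) p : (0 < N)%N -> continuous f ->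
  near1 N v (f p) -> \forall q \near p, near1 N v (f q).
Proof.
move=> N0 cf; have n0 : 0 < N%:R :> R by rewrite ltr0n.
have E x : near1 N v x = (((v./2)%:R - 1) / N%:R - 1 < x) && (x < ((v./2)%:R + 1) / N%:R - 1).
  rewrite /near1 ltr_norml !ltrBlDr !ltrBrDr !ltr_pdivrMr // ltr_pdivlMr //.
  by apply/idP/idP => /andP[a b]; apply/andP; split; lra.
rewrite E => /andP[a b]; near=> q; rewrite E; apply/andP; split; near: q.
  exact: near_gt.
exact: near_lt.
Unshelve. all: by end_near. Qed.

Lemma in_star_open N v p : (0 < N)%N -> in_star N v p ->
  \forall q \near p, in_star N v q.
Proof.
move=> N0 /and3P[s1 s2 s3]; near=> q; apply/and3P; split; near: q.
- exact: (near1_open N0 (@fst1_continuous R) s1).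
- exact: (near1_open N0 (@snd1_continuous R) s2).
- exact: (near1_open N0 (@snd_continuous R) s3).
Unshelve. all: by end_near. Qed.

Lemma in_star_face N g v p : @surface R g p -> cell_dim v = 0%N ->
  in_star N v p = face_of v (point_cell N p).
Proof.
case: v => [[v1 v2] v3] /surface_coords[[/andP[x0 _] /andP[y0 _] /andP[z0 _] _] _] v0.
have /and3P[e1 e2 e3] : [&& ~~ odd v1, ~~ odd v2 & ~~ odd v3].
  by move: v0; rewrite /cell_dim /=; case: (odd v1); case: (odd v2); case: (odd v3).
have pos (x : R) : 0 <= x -> 0 <= N%:R * (x + 1) by move=> ?; rewrite mulr_ge0 //; lra.
by rewrite /in_star /face_of /near1 /= !near_vertex // pos.
Qed.

Section FixedMesh.

Variables (N g : nat).
Hypothesis N0 : (0 < N)%N.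

Definition trace (A : set X) : {set cell N g} :=
  [set v : cell N g | (cell_dim (val v) == 0%N)
     && `[< exists2 p, A p & in_star N (val v) p >]]%SET.

Lemma traceP A (v : cell N g) : v \in trace A <->
  cell_dim (val v) = 0%N /\ exists2 p, A p & in_star N (val v) p.
Proof.
rewrite inE; split=> [/andP[/eqP v0 /asboolP vA] //|[-> vA]].
by rewrite eqxx; apply/asboolP.
Qed.

Lemma trace_ex A p : @surface R g p -> A p ->
  exists2 v, v \in trace A & in_star N (val v) p.
Proof.
move=> Sp Ap; have [t tc t0] := has_vertex (point_cell N p).
have [v vE] := cell_ex N0 (surface_face N0 tc (surface_point_cell N0 Sp)).
have vp : in_star N (val v) p by rewrite vE (in_star_face _ Sp).
by exists v => //; apply/traceP; split; [rewrite vE | exists p].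
Qed.

Lemma star_connected A p (v w : cell N g) : @surface R g p -> A p ->
  cell_dim (val v) = 0%N -> cell_dim (val w) = 0%N ->
  in_star N (val v) p -> in_star N (val w) p ->
  connect (fun a b => grid_adj a b && (b \in trace A)) v w.
Proof.
move=> Sp Ap v0 w0; rewrite !(in_star_face _ Sp) // => vc wc.
have [c cE] := cell_ex N0 (surface_point_cell N0 Sp); rewrite -cE in vc wc.
have := corners_connect N0 v0 w0 vc wc; apply: connect_sub => a b /andP[ab bc].
apply: connect1; rewrite ab; have /and3P[_ /eqP b0 _] := ab.
by apply/traceP; split=> //; exists p; rewrite ?(in_star_face _ Sp) -?cE.
Qed.

(** The stars of the lattice points reached from [v] form an open set, and so do the stars of the
    others. On [A] the two are disjoint by [star_connected] and they cover [A], so the first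
    contains all of [A]. *)
Lemma trace_connected A : A `<=` @surface R g -> connected A ->
  connected_in (@grid_adj N g) (trace A).
Proof.
move=> AS cA v w vA wA; set Q := (X in connect X).
pose U := [set p : X | exists2 u : cell N g,
  connect Q v u /\ cell_dim (val u) = 0%N & in_star N (val u) p].
pose U' := [set p : X | exists2 u : cell N g,
  ~~ connect Q v u /\ cell_dim (val u) = 0%N & in_star N (val u) p].
have oU (P : cell N g -> Prop) : open [set p : X | exists2 u : cell N g, P u & in_star N (val u) p].
  rewrite openE => p [u Pu up]; rewrite /interior /=; near=> q.
  by exists u => //; near: q; exact: in_star_open.
have AU : A `&` U = A `&` ~` U'.
  apply/seteqP; split=> p [Ap H]; split=> //.
    case: H => u [vu u0] up [u' [/negP nvu' u'0] u'p].
    apply: nvu'; apply: connect_trans vu _; exact: (star_connected (AS _ Ap) Ap).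
  have [u uA up] := trace_ex (AS _ Ap) Ap; have /traceP[u0 _] := uA.
  by exists u => //; split=> //; apply: contra_notT H => nvu; exists u.
have /traceP[v0 [p Ap vp]] := vA; have /traceP[w0 [q Aq wq]] := wA.
have BA : A `&` U = A.
  apply: cA; first by exists p; split=> //; exists v; rewrite ?connect0.
    by exists U => //; exact: oU.
  by exists (~` U') => //; apply: open_closedC; exact: oU.
have : (A `&` U) q by rewrite BA.
case=> _ [u [vu u0] uq]; apply: connect_trans vu _.
exact: (star_connected (AS _ Aq) Aq).
Unshelve. all: by end_near. Qed.

End FixedMesh.

Lemma near1_far (f : X -> R) (x y : X) : continuous f -> f x != f y ->
  exists U V M, [/\ nbhs x U, nbhs y V &
    forall N v x' y', (M <= N)%N -> U x' -> V y' ->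
      near1 N v (f x') -> near1 N v (f y') -> False].
Proof.
move=> cf; wlog lt : x y / f x < f y => [wl|_].
  rewrite neq_lt => /orP[lt|lt].
    by apply: wl => //; rewrite lt_eqF.
  have [|U [V [M [xU yV sep]]]] := wl y x lt; first by rewrite lt_eqF.
  by exists V, U, M; split=> // N v x' y' MN Vx Uy sx sy; apply: (sep N v y' x').
(* Near [x] and [y] the values of [f] stay more than [2 * d] apart, whereas two points of one star
   differ by less than [2 / N]; the threshold ensures [1 / N < d]. *)
pose d := (f y - f x) / 4; have d0 : 0 < d by rewrite /d; lra.
exists [set x' | f x' < f x + d], [set y' | f y - d < f y'], (Num.truncn (1 / d)).+1.
split; [apply: near_lt => //; lra|apply: near_gt => //; lra|].
move=> N v x' y' MN /= xd yd; rewrite /near1 !ltr_norml => /andP[a1 a2] /andP[b1 b2].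
have Nd : 1 < N%:R * d.
  rewrite -ltr_pdivrMr //.
  apply: lt_le_trans (_ : (Num.truncn (1 / d)).+1%:R <= _); last by rewrite ler_nat.
  have /truncn_itv/andP[] // : 0 <= 1 / d by rewrite divr_ge0 // ltW.
have : N%:R * (f y' - f x') < 2 by lra.
have dE : f y - f x = 4 * d by rewrite /d; lra.
nra.
Qed.

(** Points of [A] and [B] differ in some coordinate, so [near1_far] separates them locally;
    compactness makes the mesh uniform. *)
Lemma in_star_separated (A B : set X) : compact A -> compact B ->
  A `&` B = set0 ->
  \forall N \near \oo, forall v p q, A p -> B q ->
    in_star N v p -> in_star N v q -> False.
Proof.
move=> /compact_near_coveringP cA /compact_near_coveringP cB AB.
pose P (N : nat) (x y : X) := forall v, in_star N v x -> in_star N v y -> False.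
have loc x y : A x -> B y -> exists U V M, [/\ nbhs x U, nbhs y V &
    forall N x' y', (M <= N)%N -> U x' -> V y' -> P N x' y'].
  move=> Ax By; have xy : x <> y.
    by move=> xy; have : (A `&` B) x; [split=> //; rewrite xy | rewrite AB].
  have [e1|e1] := eqVneq x.1.1 y.1.1; last first.
    have [U [V [M [xU yV sep]]]] := near1_far (@fst1_continuous R) e1.
    exists U, V, M; split=> // N x' y' MN Ux Vy v /and3P[s _ _] /and3P[t _ _].
    exact: (sep N v.1.1 x' y').
  have [e2|e2] := eqVneq x.1.2 y.1.2; last first.
    have [U [V [M [xU yV sep]]]] := near1_far (@snd1_continuous R) e2.
    exists U, V, M; split=> // N x' y' MN Ux Vy v /and3P[_ s _] /and3P[_ t _].
    exact: (sep N v.1.2 x' y').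
  have [e3|e3] := eqVneq x.2 y.2; last first.
    have [U [V [M [xU yV sep]]]] := near1_far (@snd_continuous R) e3.
    exists U, V, M; split=> // N x' y' MN Ux Vy v /and3P[_ _ s] /and3P[_ _ t].
    exact: (sep N v.2 x' y').
  by case: xy; case: x y e1 e2 e3 {Ax By} => [[? ?] ?] [[? ?] ?] /= -> -> ->.
(* Compactness of [B] makes the neighbourhood of [x] and the threshold for [N] independent of [y];
   compactness of [A] then removes the dependence on [x]. *)
have locA x : A x -> \forall x' \near x & N \near \oo, forall y, B y -> P N x' y.
  move=> Ax; apply: (cB _ (filter_prod (nbhs x) \oo) (fun i y => P i.2 i.1 y)) => y By.
  have [U [V [M [xU yV sep]]]] := loc x y Ax By.
  exists (V, U `*` [set N | (M <= N)%N]).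
    split=> //=; exists (U, [set N | (M <= N)%N]) => //; split=> //=.
    exact: nbhs_infty_ge.
  by case=> y' [x' N] /= [Vy [Ux MN]]; exact: sep.
have H := cA _ \oo (fun N x => forall y, B y -> P N x y) _ locA.
near=> N => v p q Ap Bq; have : A `<=` (fun x => forall y, B y -> P N x y).
  by near: N; exact: H.
by move=> /(_ p Ap q Bq v).
Unshelve. all: by end_near. Qed.

End Trace.

(** * Branch sets from an embedding *)

(** Each arc is cut into thirds. The thirds at [u] form the set [A u] and the middle thirds the
    links of [grow_branch_sets]; pieces that are disjoint have disjoint traces once the mesh is
    fine. *)
Lemma embeddable_branch_sets (R : realType) (g : nat) (T : finType) (G : sgraph T) :
  embeddable R (@surface R g) G ->
  exists2 N, (0 < N)%N & exists B : T -> {set cell N g},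
    [/\ forall u x, x \in B u -> cell_dim (val x) = 0%N,
        forall u, exists x, x \in B u,
        forall u v x, x \in B u -> x \in B v -> u = v,
        forall u, connected_in (@grid_adj N g) (B u)
      & forall u v, G u v -> exists x y, [/\ x \in B u, y \in B v & grid_adj x y]].
Proof.
case=> pos [arc [[pos_inj posS] arcP arcS arc_pos arc_cross]].
(* Orienting every edge by the ranks of its ends gives each arc a single parametrisation, with a
   definite first and last third. *)
pose E u v := G u v && (enum_rank u < enum_rank v)%N.
have EG u v : E u v -> G u v by case/andP.
have edgeE u v : E u v -> [set u; v]%SET \in edge_set G.
  by move=> /EG uv; apply/imsetP; exists (u, v); rewrite ?inE.
have edge_inj a b c d : E a b -> E c d -> [set a; b]%SET = [set c; d]%SET -> a = c /\ b = d.
  move=> /andP[_ ab] /andP[_ cd] eq.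
  have : a \in [set c; d]%SET by rewrite -eq !inE eqxx.
  have : b \in [set c; d]%SET by rewrite -eq !inE eqxx orbT.
  have ne (x y : T) : (enum_rank x < enum_rank y)%N -> x <> y by move=> lt xy; rewrite xy ltnn in lt.
  rewrite !inE => /orP[]/eqP bE /orP[]/eqP aE //.
  - by case: (ne _ _ ab); rewrite aE bE.
  - by move: ab; rewrite aE bE ltnNge ltnW.
  - by case: (ne _ _ ab); rewrite aE bE.
have /fin_all_exists[h hP] : forall e : T * T, exists h : R -> R * R * R, E e.1 e.2 ->
    [/\ {within `[0, 1], continuous h}, {in `[0, 1] &, injective h},
        h 0 = pos e.1, h 1 = pos e.2 & h @` `[0, 1] = arc [set e.1; e.2]%SET].
  move=> [u v]; case: (boolP (E u v)) => [uv|_]; last by exists (fun=> pos u).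
  by have [h ?] := arcP _ _ (EG _ _ uv); exists h.
have hS u v t : E u v -> 0 <= t <= 1 -> surface g (h (u, v) t).
  move=> uv t01; apply: (arcS _ (edgeE _ _ uv)); have [_ _ _ _ <-] := hP (u, v) uv.
  by exists t => //=; rewrite in_itv.
have h_inj u v s t : E u v -> 0 <= s <= 1 -> 0 <= t <= 1 ->
    h (u, v) s = h (u, v) t -> s = t.
  move=> uv s01 t01; have [_ inj _ _ _] := hP (u, v) uv.
  by apply: inj => //; apply/mem_set; rewrite /= in_itv.
have h0 u v : E u v -> h (u, v) 0 = pos u by case/(hP (u, v)).
have h1 u v : E u v -> h (u, v) 1 = pos v by case/(hP (u, v)).
have h_pos u v t w : E u v -> 0 <= t <= 1 -> h (u, v) t = pos w ->
    w = u /\ t = 0 \/ w = v /\ t = 1.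
  move=> uv t01 tw; have [_ _ _ _ im] := hP (u, v) uv.
  have : w \in [set u; v]%SET.
    apply: arc_pos (edgeE _ _ uv) _; rewrite -im -tw; exists t => //=.
  rewrite !inE => /orP[]/eqP wE; [left|right]; split=> //.
    by apply: (h_inj u v t 0) => //; [rewrite lexx ler01|rewrite tw wE h0].
  by apply: (h_inj u v t 1) => //; [rewrite lexx ler01|rewrite tw wE h1].
(* An inner point of an arc that lies on a second arc would be some [pos w], and an arc contains
   such points only at its ends. *)
have h_cross u v u' v' s t : E u v -> E u' v' -> 0 < s < 1 -> 0 <= t <= 1 ->
    h (u, v) s = h (u', v') t -> [/\ u = u', v = v' & s = t].
  move=> uv uv' /andP[s0 s1] t01 st; have s01 : 0 <= s <= 1 by rewrite !ltW.
  have [eq|/eqP ne] := eqVneq [set u; v]%SET [set u'; v']%SET.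
    have [uu vv] := edge_inj _ _ _ _ uv uv' eq; rewrite -uu -vv in st *.
    by split=> //; apply: h_inj uv s01 t01 st.
  have [_ _ _ _ im] := hP (u, v) uv; have [_ _ _ _ im'] := hP (u', v') uv'.
  have [w _ wE] : range pos (h (u, v) s).
    apply: (arc_cross _ _ (edgeE _ _ uv) (edgeE _ _ uv')); first exact/eqP.
    split; first by rewrite -im; exists s => //=; rewrite in_itv.
    by rewrite -im' st; exists t => //=; rewrite in_itv.
  by case: (h_pos _ _ _ _ uv s01 (esym wE)) => -[_ sE]; move: s0 s1; rewrite sE ltxx.
have sub01 a b : 0 <= a -> b <= 1 -> `[a, b] `<=` `[0, 1 : R].
  by move=> a0 b1 t /=; rewrite !in_itv /= => /andP[at_ tb]; rewrite (le_trans a0) // (le_trans tb).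
have h_compact u v a b : E u v -> 0 <= a -> b <= 1 -> compact (h (u, v) @` `[a, b]).
  move=> uv a0 b1; have [cont _ _ _ _] := hP (u, v) uv.
  exact: (continuous_compact (continuous_subspaceW (sub01 _ _ a0 b1) cont) (@segment_compact R a b)).
have h_connected u v a b : E u v -> 0 <= a -> b <= 1 -> connected (h (u, v) @` `[a, b]).
  move=> uv a0 b1; have [cont _ _ _ _] := hP (u, v) uv.
  exact: (connected_continuous_connected (@segment_connected R a b)
            (continuous_subspaceW (sub01 _ _ a0 b1) cont)).
(* [leg u w] is the third near [u] of the arc [uw] and [mid u v] the middle third
   of [uv]. When [uw] is not an edge, [leg u w] is the point [pos u]. *)
pose leg u w := if E u w then h (u, w) @` `[0, 3^-1]
  else if E w u then h (w, u) @` `[2 / 3, 1] else [set pos u].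
pose mid u v := if E u v then h (u, v) @` `[3^-1, 2 / 3] else set0.
have [c31 c34] : (0 : R) <= 3^-1 /\ (2 / 3 : R) <= 1 by split; lra.
have legE u w p : leg u w p -> p = pos u \/ exists a b t,
    [/\ E a b, 0 < t < 1, p = h (a, b) t & u = a /\ t <= 3^-1 \/ u = b /\ 2 / 3 <= t].
  rewrite /leg; case: ifP => [uw|_]; last case: ifP => [wu|_]; last by left.
    case=> t /=; rewrite in_itv /= => /andP[t0 t3] <-.
    have [t00|tn0] := eqVneq t 0; first by left; rewrite t00 h0.
    right; exists u, w, t; split=> //; last by left.
    by rewrite lt_neqAle eq_sym tn0 t0 /=; lra.
  case=> t /=; rewrite in_itv /= => /andP[t2 t1] <-.
  have [t11|tn1] := eqVneq t 1; first by left; rewrite t11 h1.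
  right; exists w, u, t; split=> //; last by right.
  by rewrite [t < 1]lt_neqAle tn1 t1 andbT; lra.
have midE u v p : mid u v p -> exists t, [/\ E u v, 3^-1 <= t <= 2 / 3 & p = h (u, v) t].
  by rewrite /mid; case: ifP => // uv [t /=]; rewrite in_itv /= => t3 <-; exists t.
have leg_pos u w : leg u w (pos u).
  rewrite /leg; case: ifP => [uw|_]; last case: ifP => [wu|_] //.
    by exists 0; rewrite ?h0 //= in_itv /= lexx.
  by exists 1; rewrite ?h1 //= in_itv /= lexx andbT.
have leg_disj u w u' w' : u != u' -> leg u w `&` leg u' w' = set0.
  move=> uu'; rewrite -subset0 => p [].
  move=> /legE[pu|[a [b [t [ab t01 pt ut]]]]] /legE[pu'|[a' [b' [t' [ab' t01' pt' ut']]]]].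
  - by move/eqP: uu'; apply; apply: pos_inj; rewrite -pu.
  - have /andP[t0 t1] := t01'; have t02 : 0 <= t' <= 1 by rewrite !ltW.
    by case: (h_pos _ _ _ u ab' t02) => [|[_ tE]|[_ tE]];
      [rewrite -pt'|move: t0; rewrite tE ltxx|move: t1; rewrite tE ltxx].
  - have /andP[t0 t1] := t01; have t02 : 0 <= t <= 1 by rewrite !ltW.
    by case: (h_pos _ _ _ u' ab t02) => [|[_ tE]|[_ tE]];
      [rewrite -pt|move: t0; rewrite tE ltxx|move: t1; rewrite tE ltxx].
  - have /andP[t0 t1] := t01'; have t02 : 0 <= t' <= 1 by rewrite !ltW.
    have [aa bb tt] := h_cross _ _ _ _ _ _ ab ab' t01 t02 (etrans (esym pt) pt').
    case: ut => -[uE tu]; case: ut' => -[uE' tu'].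
    + by move/eqP: uu'; apply; rewrite uE uE'.
    + by move: tu tu'; rewrite tt; lra.
    + by move: tu tu'; rewrite tt; lra.
    + by move/eqP: uu'; apply; rewrite uE uE'.
have leg_mid u w a b : u != a -> u != b -> leg u w `&` mid a b = set0.
  move=> /eqP ua /eqP ub; rewrite -subset0 => p [/legE pl /midE[t [ab /andP[t1 t2] pt]]].
  have t01 : 0 <= t <= 1 by apply/andP; split; lra.
  case: pl => [pu|[a' [b' [s [ab' s01 ps us]]]]].
    by case: (h_pos _ _ _ u ab t01) => [|[]|[]//]; rewrite -?pt.
  have [aa bb _] := h_cross _ _ _ _ _ _ ab' ab s01 t01 (etrans (esym ps) pt).
  by case: us => -[uE _]; [apply: ua; rewrite uE|apply: ub; rewrite uE].
have mid_disj a b a' b' : (a, b) != (a', b') -> mid a b `&` mid a' b' = set0.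
  move=> /eqP ne; rewrite -subset0 => p [].
  move=> /midE[t [ab /andP[t1 t2] pt]] /midE[s [ab' /andP[s1 s2] ps]].
  have t01 : 0 < t < 1 by apply/andP; split; lra.
  have s01 : 0 <= s <= 1 by apply/andP; split; lra.
  have [aa bb _] := h_cross _ _ _ _ _ _ ab ab' t01 s01 (etrans (esym pt) ps).
  by apply: ne; rewrite aa bb.
(* [true] marks legs and [false] middle thirds. The index type is finite, so one mesh separates all
   disjoint pairs of pieces. *)
pose piece (j : bool * (T * T)) := if j.1 then leg j.2.1 j.2.2 else mid j.2.1 j.2.2.
have piece_compact j : compact (piece j).
  case: j => -[] [u v]; rewrite /piece /=.
    rewrite /leg; case: ifP => [uv|_]; first by apply: h_compact => //; lra.
    case: ifP => [vu|_]; first by apply: h_compact => //; lra.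
    exact: compact_set1.
  by rewrite /mid; case: ifP => [uv|_]; [apply: h_compact => //; lra|exact: compact0].
have sep (jj : (bool * (T * T)) * (bool * (T * T))) : \forall N \near \oo,
    piece jj.1 `&` piece jj.2 = set0 -> forall v p q, piece jj.1 p -> piece jj.2 q ->
    in_star N v p -> in_star N v q -> False.
  have [d|nd] := pselect (piece jj.1 `&` piece jj.2 = set0); last by near=> N => /nd.
  near=> N => _; near: N.
  exact: (in_star_separated (piece_compact jj.1) (piece_compact jj.2) d).
have {}sep := filter_forall eventually_filter sep.
have [N [N0 sepN]] : exists N, (0 < N)%N /\ forall jj : (bool * (T * T)) * (bool * (T * T)),
    piece jj.1 `&` piece jj.2 = set0 -> forall v p q, piece jj.1 p -> piece jj.2 q ->
    in_star N v p -> in_star N v q -> False.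
  apply: (@filter_ex _ \oo); near=> N; split; near: N; [exact: nbhs_infty_gt|exact: sep].
exists N => //.
pose A u := trace N g (\bigcup_w leg u w); pose M u v := trace N g (mid u v).
have AP u x : x \in A u -> exists w p, leg u w p /\ in_star N (val x) p.
  by case/traceP=> _ [p [w _ wp] xp]; exists w, p.
have MP u v x : x \in M u v -> exists2 p, mid u v p & in_star N (val x) p by case/traceP.
have legS u w : leg u w `<=` surface g.
  move=> p /legE[->|[a [b [t [ab /andP[t0 t1] -> _]]]]]; first exact: posS.
  by apply: hS => //; rewrite !ltW.
have midS u v : mid u v `<=` surface g.
  by move=> p /midE[t [uv /andP[t1 t2] ->]]; apply: hS => //; apply/andP; split; lra.
have AuS u : \bigcup_w leg u w `<=` surface g by move=> p [w _]; exact: legS.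
have Aconn u : connected (\bigcup_w leg u w).
  apply: bigcup_connected; first by exists (pos u) => w _; exact: leg_pos.
  move=> w _; rewrite /leg; case: ifP => [uw|_]; first by apply: h_connected => //; lra.
  case: ifP => [wu|_]; first by apply: h_connected => //; lra.
  exact: connected1.
have meet u v p : mid u v p -> forall u' w, leg u' w p -> exists x, (x \in M u v) && (x \in A u').
  move=> mp u' w lp; have [x xM xp] := trace_ex N0 (midS _ _ _ mp) mp.
  exists x; rewrite xM; have /traceP[x0 _] := xM; apply/traceP; split=> //.
  by exists p => //; exists w.
have [] := @grow_branch_sets _ _ (@grid_adj N g) E A M (@grid_adj_sym N g).
- by move=> u v /andP[_ uv]; rewrite /E negb_and -leqNgt (ltnW uv) orbT.
- move=> u; have Au : (\bigcup_w leg u w) (pos u) by exists u.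
  have [x xA _] := trace_ex N0 (posS u) Au.
  by exists x.
- by move=> u; exact: trace_connected.
- move=> u v x /AP[w [p [wp xp]]] /AP[w' [q [wq xq]]]; apply/eqP/negPn/negP => uv.
  exact: (sepN ((true, (u, w)), (true, (v, w'))) (leg_disj _ _ _ _ uv) _ _ _ wp wq xp xq).
- move=> u v uv; apply: trace_connected => //; rewrite /mid uv; apply: h_connected => //; lra.
- move=> u v uv; apply: (meet u v (h (u, v) 3^-1) _ u v).
    by rewrite /mid uv; exists 3^-1 => //=; rewrite in_itv /= lexx; lra.
  by rewrite /leg uv; exists 3^-1 => //=; rewrite in_itv /= lexx andbT.
- move=> u v uv; apply: (meet u v (h (u, v) (2 / 3)) _ v u).
    by rewrite /mid uv; exists (2 / 3) => //=; rewrite in_itv /= lexx andbT; lra.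
  have nvu : E v u = false.
    by apply/negP => /andP[_ vu]; case/andP: uv => _ uv; rewrite ltnNge ltnW in vu.
  by rewrite /leg nvu uv; exists (2 / 3) => //=; rewrite in_itv /= lexx; lra.
- move=> u v w x uv /MP[p pm xp] /AP[w' [q [wq xq]]].
  have [->|wu] := eqVneq w u; first by left.
  have [->|wv] := eqVneq w v; first by right.
  by case: (sepN ((true, (w, w')), (false, (u, v))) (leg_mid _ _ _ _ wu wv) _ _ _ wq pm xq xp).
- move=> u v u' v' x uv uv' /MP[p pm xp] /MP[q qm xq].
  have [[-> ->]//|ne] := eqVneq (u, v) (u', v').
  by case: (sepN ((false, (u, v)), (false, (u', v'))) (mid_disj _ _ _ _ ne) _ _ _ pm qm xp xq).
move=> B [Bex Bdisj Bconn Badj Bsub]; exists B; split=> //.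
  by move=> u x /Bsub[/traceP[]|[v _ /traceP[]]].
move=> u v uv; have [lt|lt|eq] := ltngtP (enum_rank u) (enum_rank v).
- by apply: Badj; rewrite /E uv.
- have [|x [y [xB yB xy]]] := Badj v u; first by rewrite /E adj_sym uv.
  by exists y, x; split=> //; rewrite grid_adj_sym.
- by move: uv; rewrite (enum_rank_inj (val_inj eq)) adj_irrefl.
Unshelve. all: by end_near. Qed.

(** * Binary digits, layers and the final representation *)

Definition bit (i a : nat) : bool := odd (a %/ 2 ^ i).

Lemma bits_inj c a b : (a < 2 ^ c)%N -> (b < 2 ^ c)%N ->
  (forall i, (i < c)%N -> bit i a = bit i b) -> a = b.
Proof.
elim: c a b => [|c IH] a b; first by rewrite expn0 !ltnS !leqn0 => /eqP-> /eqP->.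
rewrite expnS => ac bc ab; rewrite -[a]odd_double_half -[b]odd_double_half.
have := ab 0%N isT; rewrite /bit expn0 !divn1 => ->; congr (_ + _.*2)%N.
apply: IH; try lia.
by move=> i ic; have := ab i.+1 ic; rewrite /bit expnS !divnMA !divn2.
Qed.

Section BitGraph.

Variables (T : finType) (G : sgraph T) (code : T -> nat) (i : nat).

Definition bit_rel (x y : T) : bool :=
  (x != y) && ((bit i (code x) == bit i (code y)) || G x y).

Lemma bit_rel_sym : symmetric bit_rel.
Proof. by move=> x y; rewrite /bit_rel eq_sym [bit _ _ == _]eq_sym adj_sym. Qed.

Lemma bit_rel_irrefl : irreflexive bit_rel.
Proof. by move=> x; rewrite /bit_rel eqxx. Qed.

Definition bit_graph : sgraph T := SGraph bit_rel_sym bit_rel_irrefl.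

Lemma bit_graph_co_bipartite : co_bipartite bit_graph.
Proof.
exists [set x | bit i (code x)]%SET => x y /= /andP[xy].
by rewrite /bit_rel xy /= negb_or !inE => /andP[].
Qed.

End BitGraph.

Section LayerGraph.

Variables (T : finType) (ell : T -> nat).

Definition layer_rel (x y : T) : bool :=
  [&& x != y, (ell x <= (ell y).+1)%N & (ell y <= (ell x).+1)%N].

Lemma layer_rel_sym : symmetric layer_rel.
Proof. by move=> x y; rewrite /layer_rel eq_sym; congr andb; exact: andbC. Qed.

Lemma layer_rel_irrefl : irreflexive layer_rel.
Proof. by move=> x; rewrite /layer_rel eqxx. Qed.

Definition layer_graph : sgraph T := SGraph layer_rel_sym layer_rel_irrefl.

(** Each vertex gets the unit interval starting at its layer number. Two such intervals meet when
    the layers differ by at most one, the larger left end being a common point. *)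
Lemma layer_graph_unit_interval (R : realType) : unit_interval R layer_graph.
Proof.
exists (fun x => (ell x)%:R) => x y /=; rewrite /layer_rel; split.
  case/and3P=> xy; rewrite -!(ler_nat R) -!natr1 => xl yl; split=> //.
  exists (Num.max (ell x)%:R (ell y)%:R); split; rewrite /= in_itv /= le_max lexx ?orbT /= ge_max; lra.
case=> xy [z [/=]]; rewrite !in_itv /= => /andP[xz zx] /andP[yz zy].
by rewrite xy -!(ler_nat R) -!natr1; apply/andP; split; lra.
Qed.

End LayerGraph.

(** The codes lie below [2 * ((euler_defect g).*2 + 8).+1], which is [960 * g + 1458], and 13 binary
    digits beyond the logarithm of [g] are enough for them. *)
Definition num_co_bipartite (g : nat) : nat := (trunc_log 2 g + 13)%N.

Lemma num_co_bipartite_ge g :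
  (2 * ((euler_defect g).*2 + 8).+1 <= 2 ^ num_co_bipartite g)%N.
Proof.
rewrite /num_co_bipartite expnD /euler_defect.
have [->|g0] := posnP g; first by [].
have := @trunc_log_ltn 2 g isT; rewrite [(2 ^ (trunc_log 2 g).+1)%N]expnS.
by rewrite (_ : 2 ^ 13 = 64 * 128)%N //; move: (2 ^ trunc_log 2 g)%N => t; lia.
Qed.

Lemma num_co_bipartite_log (R : realType) :
  (fun g : nat => (num_co_bipartite g)%:R : R) =O_\oo (fun g : nat => ln (g%:R : R)).
Proof.
have ln2 : 0 < ln (2 : R) by rewrite ln_gt0 // ltr1n.
(* For [g >= 2] the truncated logarithm [t] is at least 1, so [t + 13 <= 14 * t], and
   [t * ln 2 <= ln g]. *)
apply/eqO_exP; exists (14 / ln 2); first by rewrite divr_gt0.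
near=> g; have g2 : (2 <= g)%N by near: g; exact: nbhs_infty_ge.
have g0 : (0 < g)%N by lia.
have lng : (trunc_log 2 g)%:R * ln 2 <= ln (g%:R : R).
  rewrite mulr_natl -lnXn // ler_ln ?posrE ?exprn_gt0 ?ltr0n //.
  by rewrite -natrX ler_nat trunc_logP.
have t1 : (1 <= trunc_log 2 g)%N by rewrite trunc_log_max.
rewrite ger0_norm // ger0_norm; last by rewrite ln_ge0 // ler1n.
apply: (@le_trans _ _ (14 / ln 2 * ((trunc_log 2 g)%:R * ln 2))).
  rewrite [leRHS]mulrACA mulVf ?gt_eqF // mulr1 -natrM ler_nat /num_co_bipartite.
  lia.
by rewrite ler_pM2l // divr_gt0.
Unshelve. all: by end_near. Qed.

Theorem theorem7 (R : realType) :
  exists c : nat -> nat,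
    (fun g : nat => (c g)%:R : R) =O_\oo (fun g : nat => ln (g%:R : R)) /\
    forall (g : nat) (T : finType) (G : sgraph T),
      connected_graph G -> has_genus R G g ->
      exists (H : 'I_(c g) -> sgraph T) (U C : sgraph T),
        [/\ forall i, co_bipartite (H i),
            unit_interval R U,
            chordal C &
            forall x y : T, G x y = [&& [forall i, H i x y], U x y & C x y]].
Proof.
exists num_co_bipartite; split; first exact: num_co_bipartite_log.
move=> g T G cG [/embeddable_branch_sets[N N0 [B [Bdim Bex Bdisj Bconn Badj]]] _].
have [ell [C [col [[Csym Cirr] Cch CG ellG colP]]]] :=
  grid_minor_decomposition N0 cG (adj_irrefl G) Bdim Bex Bdisj Bconn Badj.
(* The lowest digit is the parity of the layer, and the remaining ones are the colour. *)
pose code x := (odd (ell x) + (col x).*2)%N.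
exists (fun i => bit_graph G code i), (layer_graph ell), (SGraph Csym Cirr); split.
- by move=> i; exact: bit_graph_co_bipartite.
- exact: layer_graph_unit_interval.
- by move=> n f n4; exact: Cch.
move=> x y /=; apply/idP/and3P => [xy|[/forallP Hxy /and3P[xy lxy lyx] Cxy]].
  have nxy : x != y by apply: contraTneq xy => ->; rewrite adj_irrefl.
  split; last exact: CG.
    by apply/forallP => i; rewrite /= /bit_rel nxy xy orbT.
  by rewrite /layer_rel nxy !ellG // adj_sym.
apply: contraT => nG; have code_lt z : (code z < 2 ^ num_co_bipartite g)%N.
  apply: leq_trans (num_co_bipartite_ge g); rewrite /code.
  by have := ltn_ord (col z); case: odd; lia.
have : code x = code y.
  apply: bits_inj (code_lt x) (code_lt y) _ => i ic.
  by have := Hxy (Ordinal ic); rewrite /= /bit_rel xy (negPf nG) orbF => /eqP.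
(* Equal codes mean equal colours and layers of equal parity. Layers of vertices adjacent in
   [layer_graph] differ by at most one, so here they coincide, against [colP]. *)
have [eqo|neo] := eqVneq (odd (ell x)) (odd (ell y)); last first.
  by move/(congr1 odd)/eqP; rewrite /code !oddD !odd_double !addbF !oddb (negPf neo).
rewrite /code eqo => /addnI/double_inj/val_inj cxy.
have exy : ell x = ell y by move: eqo lxy lyx; lia.
by have := colP _ _ Cxy exy; rewrite cxy eqxx.
Qed.
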